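(* Fix a prime $b$. Let $\boldsymbol{\gamma}=(\gamma_{\mathfrak{u}})$ be a family of positive weights indexed by all finite subsets $\mathfrak{u}\subset\mathbb{N}$ (restricted to subsets of $\{1,\ldots,d\}$ when the dimension is $d$), satisfying $$\sum_{j\ge1}\ \max_{\mathfrak{v}\subseteq\{1,\ldots,j-1\}}\frac{\gamma_{\mathfrak{v}\cup\{j\}}}{\gamma_{\mathfrak{v}}}<\infty.$$ Then for every $\delta>0$ there is a constant $C_1(\boldsymbol{\gamma},\delta)>0$, independent of $d$ and $N$, such that the following holds for all $m,d\in\mathbb{N}$ with $m\ge4$, $N=b^m$, all irreducible $p\in\mathbb{F}_b[x]$ with $\deg(p)=m$, and each $\alpha>1$: Algorithm 1 (described in the context), run with modulus $p$ and weights $\boldsymbol{\eta}=\boldsymbol{\gamma}=(\gamma_{\mathfrak{u}})_{\mathfrak{u}\subseteq\{1,\ldots,d\}}$, constructs a generating vector $\boldsymbol{g}\in(G^*_{b,m})^d$ such that the worst-case error for the weights $\boldsymbol{\gamma}^\alpha=(\gamma_{\mathfrak{u}}^\alpha)_{\mathfrak{u}}$ satisfies $$e_{b^m,d,\alpha,\boldsymbol{\gamma}^\alpha}(\boldsymbol{g})\le\frac{1}{N^\alpha}\left(\sum_{\emptyset\ne\mathfrak{u}\subseteq\{1,\ldots,d\}}\gamma_{\mathfrak{u}}^\alpha\,(2\mu_b(\alpha))^{|\mathfrak{u}|}+\left(C_1(\boldsymbol{\gamma},\delta)\right)^\alpha N^{\alpha\delta}\right).$$ Additionally, let $\alpha>1$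 and suppose that $$\sum_{j\ge1}\ \max_{\mathfrak{v}\subseteq\{1,\ldots,j-1\}}\left(\frac{\gamma_{\mathfrak{v}\cup\{j\}}}{\gamma_{\mathfrak{v}}}\right)^{1/\alpha}<\infty.$$ Then for every $\delta>0$ there is a constant $C_2(\boldsymbol{\gamma}^{1/\alpha},\delta)>0$, independent of $d$ and $N$, such that for all $m,d\in\mathbb{N}$ with $m\ge4$, $N=b^m$, and all irreducible $p\in\mathbb{F}_b[x]$ with $\deg(p)=m$, Algorithm 1, run with modulus $p$ and weights $\boldsymbol{\eta}=\boldsymbol{\gamma}^{1/\alpha}=(\gamma_{\mathfrak{u}}^{1/\alpha})_{\mathfrak{u}\subseteq\{1,\ldots,d\}}$, constructs a generating vector $\widetilde{\boldsymbol{g}}\in(G^*_{b,m})^d$ such that $$e_{b^m,d,\alpha,\boldsymbol{\gamma}}(\widetilde{\boldsymbol{g}})\le\frac{1}{N^\alpha}\left(\sum_{\emptyset\ne\mathfrak{u}\subseteq\{1,\ldots,d\}}\gamma_{\mathfrak{u}}\,(2\mu_b(\alpha))^{|\mathfrak{u}|}+\left(C_2(\boldsymbol{\gamma}^{1/\alpha},\delta)\right)^\alpha N^{\alpha\delta}\right).$$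
   Context: $\mathbb{F}_b$ is the field with $b$ elements ($b$ prime), identified with $\{0,1,\ldots,b-1\}$. $G^*_{b,m}:=\{g\in\mathbb{F}_b[x]\setminus\{0\}:\deg(g)<m\}$. An integer $n\in\mathbb{N}_0$ with base-$b$ expansion $n=n_0+n_1b+\cdots+n_ab^a$ is associated with the polynomial $n(x)=\sum_{k=0}^a n_kx^k\in\mathbb{F}_b[x]$. The map $v_m$ from $\mathbb{F}_b((x^{-1}))$ to $[0,1)$ is $v_m\left(\sum_{\ell=w}^\infty t_\ell x^{-\ell}\right)=\sum_{\ell=\max(1,w)}^m t_\ell b^{-\ell}$, applied component-wise to vectors; rational functions are regarded as elements of $\mathbb{F}_b((x^{-1}))$. Polynomial lattice rule: for $p\in\mathbb{F}_b[x]$ with $\deg(p)=m$ and $\boldsymbol{g}\in(\mathbb{F}_b[x])^d$, the polynomial lattice $P(\boldsymbol{g},p)$ consists of the $b^m$ points $\boldsymbol{x}_n=\left(v_m\left(\frac{n(x)g_1(x)}{p(x)}\right),\ldots,v_m\left(\frac{n(x)g_d(x)}{p(x)}\right)\right)\in[0,1)^d$, $0\le n<b^m$, and $Q_{b^m,d}(f;P(\boldsymbol{g},p))=\frac{1}{b^m}\sum_{n=0}^{b^m-1}f(\boldsymbol{x}_n)$. Also $I_d(f)=\int_{[0,1]^d}f(\boldsymbol{x})\,d\boldsymbol{x}$. Walsh functions: for $k\in\mathbb{N}_0$ with $k=\kappa_0+\kappa_1b+\cdots+\kappa_{a-1}b^{a-1}$ and $x\in[0,1)$ with $x=\xi_1b^{-1}+\xi_2b^{-2}+\cdots$,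 $\xi_i\in\{0,\ldots,b-1\}$ (infinitely many $\xi_i\ne b-1$), $\mathrm{wal}_k(x):=e^{2\pi\mathrm{i}(\kappa_0\xi_1+\cdots+\kappa_{a-1}\xi_a)/b}$, and $\mathrm{wal}_{\boldsymbol{k}}(\boldsymbol{x})=\prod_{j=1}^d\mathrm{wal}_{k_j}(x_j)$. The Walsh coefficients of $f\in L^2([0,1]^d)$ are $\hat f(\boldsymbol{k})=\int_{[0,1]^d}f(\boldsymbol{x})\overline{\mathrm{wal}_{\boldsymbol{k}}(\boldsymbol{x})}\,d\boldsymbol{x}$. Weighted Walsh space: for $\alpha>1$ and positive weights $\boldsymbol{\gamma}=(\gamma_{\mathfrak{u}})_{\mathfrak{u}\subseteq\{1,\ldots,d\}}$ put $r_{\alpha,\boldsymbol{\gamma}}(\boldsymbol{k}):=\gamma_{\mathrm{supp}(\boldsymbol{k})}^{-1}\prod_{j\in\mathrm{supp}(\boldsymbol{k})}b^{\alpha\lfloor\log_b(k_j)\rfloor}$ with $\mathrm{supp}(\boldsymbol{k})=\{j:k_j\ne0\}$. $W^\alpha_{d,\boldsymbol{\gamma}}$ is the space of $f\in L^2([0,1]^d)$ with $\|f\|_{W^\alpha_{d,\boldsymbol{\gamma}}}:=\sup_{\boldsymbol{k}\in\mathbb{N}_0^d}|\hat f(\boldsymbol{k})|\,r_{\alpha,\boldsymbol{\gamma}}(\boldsymbol{k})<\infty$, where the elements $f$ are understood to be represented pointwise by their Walsh series, $f(\boldsymbol{x})=\sum_{\boldsymbol{k}\in\mathbb{N}_0^d}\hat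 f(\boldsymbol{k})\,\mathrm{wal}_{\boldsymbol{k}}(\boldsymbol{x})$ for $\boldsymbol{x}\in[0,1)^d$. The worst-case error of the polynomial lattice rule with generating vector $\boldsymbol{g}$ and modulus $p$ is $$e_{b^m,d,\alpha,\boldsymbol{\gamma}}(\boldsymbol{g}):=\sup_{f\in W^\alpha_{d,\boldsymbol{\gamma}},\ \|f\|_{W^\alpha_{d,\boldsymbol{\gamma}}}\le1}\left|Q_{b^m,d}(f;P(\boldsymbol{g},p))-I_d(f)\right|.$$ Further, $\mu_b(\alpha):=\sum_{k=1}^\infty b^{-\alpha\lfloor\log_b(k)\rfloor}=\frac{b^\alpha(b-1)}{b^\alpha-b}$. For $\emptyset\ne\mathfrak{u}\subseteq\{1,\ldots,d\}$ let $L_{\mathfrak{u}}(\boldsymbol{x}_{\mathfrak{u}}):=\prod_{j\in\mathfrak{u}}\left((1-b)\lfloor\log_b(x_j)\rfloor-b\right)$ for $\boldsymbol{x}_{\mathfrak{u}}\in(0,1]^{|\mathfrak{u}|}$. For positive weights $\boldsymbol{\eta}$, $s\in\{1,\ldots,d\}$ and $(g_1,\ldots,g_s)\in(G^*_{b,m})^s$ define $$K_{b^m,s,\boldsymbol{\eta}}(g_1,\ldots,g_s):=\sum_{\emptyset\ne\mathfrak{u}\subseteq\{1,\ldots,s\}}\eta_{\mathfrak{u}}\sum_{n=1}^{b^m-1}L_{\mathfrak{u}}\left(v_m\left(\frac{n(x)\,\boldsymbol{g}_{\mathfrak{u}}(x)}{p(x)}\right)\right),\qquad\boldsymbol{g}_{\mathfrak{u}}=(g_j)_{j\in\mathfrak{u}}.$$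 Algorithm 1 (component-by-component construction), with inputs $b,m,d$, weights $\boldsymbol{\eta}$ and irreducible modulus $p$ of degree $m$: set $g_1=1$; for $s=2,\ldots,d$ let $g_s\in G^*_{b,m}$ be a minimizer of $g\mapsto K_{b^m,s,\boldsymbol{\eta}}(g_1,\ldots,g_{s-1},g)$ over $g\in G^*_{b,m}$. Output $\boldsymbol{g}=(g_1,\ldots,g_d)$; it does not depend on $\alpha$ other than through the weights $\boldsymbol{\eta}$. *)

(* Defs.v *)
From HB Require Import structures.
From mathcomp Require Import all_boot all_order all_algebra finmap complex.
From mathcomp Require Import all_classical all_reals all_analysis summability.
From mathcomp Require Import zify.

Set Implicit Arguments.
Unset Strict Implicit.
Unset Printing Implicit Defensive.

Import Order.TTheory GRing.Theory Num.Theory.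
Import numFieldNormedType.Exports.

Local Open Scope classical_set_scope.
Local Open Scope ring_scope.

(** * Weights *)

(* Coordinates are numbered from 0, so coordinate j of the usual numbering
   1, 2, ... is j.-1 here and a weight family is indexed by all finite subsets
   of nat. *)
Definition weights (R : Type) := {fset nat} -> R.

Definition fset_of_ords n (u : {set 'I_n}) : {fset nat} :=
  [fset val j | j in u]%fset.

(* gamma_u for a set u of coordinates of an n-dimensional problem *)
Definition wt (R : Type) (gamma : weights R) n (u : {set 'I_n}) : R :=
  gamma (fset_of_ords u).

Definition wpow (R : realType) (gamma : weights R) (a : R) : weights R :=
  fun u => gamma u `^ a.

Definition wratio (R : realType) (gamma : weights R) j (v : {set 'I_j}) : R :=
  gamma (j |` fset_of_ords v)%fset / wt gamma v.

(** * Laurent expansions in x^-1 of rational functions *)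

(* Elements of F((x^-1)) are represented by their coefficients: t l is the
   coefficient of x^-l.  For l >= 0 the coefficient of x^-l in q / p is the
   constant term of the polynomial part of x^l q / p. *)
Definition laurent (F : fieldType) (q p : {poly F}) (l : int) : F :=
  match l with
  | Posz n => ((q * 'X^n) %/ p)`_0
  | Negz n => (q %/ p)`_n.+1
  end.

Lemma coef_divpMXn (F : fieldType) (q p : {poly F}) (j k : nat) :
  p != 0 -> (j <= k)%N -> ((q * 'X^j) %/ p)`_k = (q %/ p)`_(k - j).
Proof.
move=> p0 jk; rewrite {1}(divp_eq q p) mulrDl mulrAC divpD mulpK//.
rewrite coefD coefMXn ltnNge jk/= [X in _ + X]nth_default ?addr0//.
have [->|r0] := eqVneq (q %% p) 0; first by rewrite mul0r div0p size_poly0.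
rewrite size_divp// size_Mmonic ?monicXn// size_polyXn.
have : (size (q %% p)%R < size p)%N by rewrite ltn_modp.
case: (size p) => // s rp.
move: rp jk; move: (size (q %% p)) => t; rewrite addnS !succnK ltnS => ts jk.
by apply: leq_trans jk; rewrite leq_subLR leq_add2r.
Qed.

Lemma laurent_subE (F : fieldType) (q p : {poly F}) (n k : nat) :
  p != 0 -> laurent q p (n%:Z - k%:Z) = ((q * 'X^n) %/ p)`_k.
Proof.
move=> p0; have [kn|nk] := leqP k n.
  by rewrite subzn//= -[in RHS](subnK kn) exprD mulrA [RHS]coef_divpMXn ?subnn.
rewrite coef_divpMXn 1?ltnW//.
have -> : n%:Z - k%:Z = Negz (k - n).-1 by rewrite NegzE prednK ?subn_gt0//; lia.
by rewrite /= prednK// subn_gt0.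
Qed.

(* p * (q / p) = q coefficientwise; with laurent_small this characterises the
   expansion of q / p. *)
Lemma laurentP (F : fieldType) (q p : {poly F}) (l : int) : p != 0 ->
  \sum_(i < size p) p`_i * laurent q p (l + i%:Z) =
  if l <= 0 then q`_`|l|%N else 0.
Proof.
move=> p0.
pose n := (`|l| + size p)%N; pose k := `|n%:Z - l|%N.
have lE : l = n%:Z - k%:Z by rewrite /k /n; lia.
have pk : (size p <= k)%N by rewrite /k /n; lia.
have /(congr1 (fun r : {poly F} => r`_k)) := divp_eq (q * 'X^n) p.
rewrite coefD [X in _ + X]nth_default ?addr0; last first.
  by rewrite (leq_trans _ pk)// ltnW// ltn_modp.
rewrite [X in _ = X]coefMr => E.
transitivity ((q * 'X^n)`_k).
  rewrite E.
  transitivity (\sum_(0 <= i < size p) p`_i * ((q * 'X^n) %/ p)`_(k - i)).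
    rewrite big_mkord; apply: eq_bigr => i _; rewrite -laurent_subE//.
    by congr (_ * laurent _ _ _); have := ltn_ord i; lia.
  rewrite -(big_mkord xpredT (fun i => ((q * 'X^n) %/ p)`_(k - i) * p`_i)).
  rewrite [RHS](big_cat_nat (n := size p))//= ?(leq_trans pk)//.
  rewrite [X in _ + X]big_nat_cond [X in _ + X]big1 ?addr0.
    by apply: eq_bigr => i _; rewrite mulrC.
  by move=> i /andP[/andP[pi _] _]; rewrite [p`_i]nth_default ?mulr0.
rewrite coefMXn; case: ltnP; case: (lerP l 0) => // ? ?; try by exfalso; lia.
by congr (_`_ _); lia.
Qed.

Lemma laurent_small (F : fieldType) (q p : {poly F}) (l : int) :
  l <= - (size q)%:Z -> laurent q p l = 0.
Proof.
case: l => [[|n]|n] /= ql.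
- move: ql; rewrite oppr_ge0 lez_nat leqn0.
  by rewrite size_poly_eq0 => /eqP ->; rewrite mul0r div0p coef0.
- by have := le_trans ql (_ : _ <= 0); rewrite oppr_le0 => /(_ isT).
- by rewrite nth_default// (leq_trans (leq_divp _ _))//; move: ql; rewrite NegzE lerN2.
Qed.

(* v_m, for F = 'F_b, whose elements coerce to their representatives in
   {0, ..., b-1} *)
Definition vmap (R : realType) (b m : nat) (t : int -> 'F_b) : R :=
  \sum_(1 <= l < m.+1) (t l%:Z : nat)%:R * b%:R ^- l.

(** * Polynomial lattice rules *)

(* n(x); the digits of index > n vanish *)
Definition nat_poly (b n : nat) : {poly 'F_b} :=
  \poly_(k < n.+1) ((n %/ b ^ k) %% b)%:R.

Definition Gstar (b m : nat) : {pred {poly 'F_b}} :=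
  [pred g : {poly 'F_b} | (g != 0) && (size g <= m)%N].
Arguments Gstar : clear implicits.

(* A point of R^d; measurableTypeR R is R with its Borel sigma-algebra. *)
Notation point R d := (d.-tuple (measurableTypeR R)).

Section polynomial_lattice.
Variables (R : realType) (b m : nat) (p : {poly 'F_b}).

Definition lattice_point d (g : d.-tuple {poly 'F_b}) (n : nat) : point R d :=
  [tuple vmap R m (laurent (nat_poly b n * tnth g j) p) | j < d].

Definition qmc_rule d (g : d.-tuple {poly 'F_b}) (f : point R d -> R[i]) :
    R[i] :=
  (b ^ m)%:R^-1 * \sum_(0 <= n < b ^ m) f (lattice_point g n).

End polynomial_lattice.

(** * Integration over the unit cube *)

Section lebesgue_cons.
Variables (R : realType) (d : nat).
Variable nu : {sigma_finite_measure set (point R d) -> \bar R}.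
Local Open Scope ereal_scope.

Definition consr (xy : measurableTypeR R * point R d) : point R d.+1 :=
  [tuple of xy.1 :: xy.2].

Lemma measurable_consr : measurable_fun [set: measurableTypeR R * point R d] consr.
Proof. exact: (measurable_cons (f := fst) (g := snd)). Qed.

Definition lebesgue_cons : set (point R d.+1) -> \bar R :=
  pushforward (lebesgue_measure \x nu) consr.

Let cons0 : lebesgue_cons set0 = 0.
Proof. by rewrite /lebesgue_cons /pushforward preimage_set0 measure0. Qed.

Let cons_ge0 A : 0 <= lebesgue_cons A.
Proof. exact: (measure_ge0 (lebesgue_measure \x nu)%E). Qed.

Let cons_sigma_additive : semi_sigma_additive lebesgue_cons.
Proof.
move=> F mF tF mUF; rewrite /lebesgue_cons /pushforward preimage_bigcup.
apply: measure_semi_sigma_additive.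
- by move=> n; rewrite -[X in measurable X]setTI; exact: measurable_consr.
- apply/trivIsetP => /= i j _ _ ij; rewrite -preimage_setI.
  by move/trivIsetP : tF => /(_ _ _ _ _ ij) ->//; rewrite preimage_set0.
- rewrite -preimage_bigcup -[X in measurable X]setTI.
  exact: measurable_consr.
Qed.

HB.instance Definition _ :=
  isMeasure.Build _ _ _ lebesgue_cons cons0 cons_ge0 cons_sigma_additive.

Let cons_sigma_finite : sigma_finite [set: point R d.+1] lebesgue_cons.
Proof.
have /sigma_finiteP[F [FT ndF Foo]] := sigma_finiteT (@lebesgue_measure R).
have /sigma_finiteP[G [GT ndG Goo]] := sigma_finiteT nu.
pose h (x : point R d.+1) : measurableTypeR R * point R d :=
  (thead x, [tuple of behead x]).
have mh : measurable_fun [set: point R d.+1] h.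
  apply/measurable_fun_pairP; split.
    exact: (measurable_tnth (n := d.+1) ord0).
  exact: measurable_behead.
exists (fun n => h @^-1` (F n `*` G n)).
  rewrite -preimage_bigcup (_ : \bigcup_n _ = setT) ?preimage_setT//.
  apply/seteqP; split=> // -[x y] _.
  have [[k _ Fx] [l _ Gy]] : (\bigcup_i F i) x /\ (\bigcup_i G i) y.
    by rewrite -FT -GT.
  exists (maxn k l) => //; split => /=.
    by move: x Fx {FT}; exact/subsetPset/ndF/leq_maxl.
  by move: y Gy {GT}; exact/subsetPset/ndG/leq_maxr.
move=> n; have [mF Fn] := Foo n; have [mG Gn] := Goo n; split.
  by rewrite -[X in measurable X]setTI; apply: mh => //; exact: measurableX.
rewrite /lebesgue_cons /pushforward -comp_preimage (_ : h \o consr = id).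
  by rewrite preimage_id product_measure1E// lte_mul_pinfty// ge0_fin_numE.
by apply/funext => -[x y]; rewrite /h /consr/=; congr pair; exact: val_inj.
Qed.

HB.instance Definition _ :=
  Measure_isSigmaFinite.Build _ _ _ lebesgue_cons cons_sigma_finite.

End lebesgue_cons.

(* d-dimensional Lebesgue measure on the Borel sets of R^d *)
Fixpoint lebesgue_tuple (R : realType) d :
    {sigma_finite_measure set (point R d) -> \bar R} :=
  match d with
  | 0 => dirac [tuple]
  | d'.+1 => lebesgue_cons (lebesgue_tuple R d')
  end.

Section cube.
Variables (R : realType) (d : nat).

Definition cube : set (point R d) := [set x | forall j, 0 <= tnth x j <= 1].

Definition cube_co : set (point R d) := [set x | forall j, 0 <= tnth x j < 1].

Definition cube_integral (f : point R d -> R[i]) : R[i] :=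
  ((\int[lebesgue_tuple R d]_(x in cube) complex.Re (f x)) +i*
   (\int[lebesgue_tuple R d]_(x in cube) complex.Im (f x)))%C.

Definition square_integrable (f : point R d -> R[i]) : Prop :=
  [/\ measurable_fun cube (fun x => complex.Re (f x) : measurableTypeR R),
      measurable_fun cube (fun x => complex.Im (f x) : measurableTypeR R) &
      (\int[lebesgue_tuple R d]_(x in cube)
        ((ComplexField.Normc.normc (f x)) ^+ 2)%:E < +oo)%E].

End cube.

(** * Walsh functions and the weighted Walsh space *)

Section walsh.
Variables (R : realType) (b : nat).

(* the i-th base-b digit (i >= 1) of x in [0, 1) *)
Definition xdigit (i : nat) (x : R) : nat := (Num.truncn (x * b%:R ^+ i) %% b)%N.

(* The strict upper bound selects the expansion with infinitely many digits
   different from b-1. *)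
Lemma xdigitP (x : R) (n : nat) : (1 < b)%N -> 0 <= x < 1 ->
  0 <= x - \sum_(1 <= i < n.+1) (xdigit i x)%:R * b%:R ^- i < b%:R ^- n.
Proof.
move=> b1 /andP[x0 x1]; rewrite subr_ge0 ltrBlDl; set s := \sum_(_ <= i < _) _.
have b0 : 0 < b%:R :> R by rewrite ltr0n ltnW.
have sE : s = (Num.truncn (x * b%:R ^+ n))%:R * b%:R ^- n.
  rewrite {}/s; elim: n => [|n IH].
    by rewrite big_nil expr0 !mulr1 invr1 mulr1 (truncn_def (n := 0%N)) ?x0.
  rewrite big_nat_recr//= IH.
  set y := x * b%:R ^+ n; set T := Num.truncn _.
  have y0 : 0 <= y by rewrite mulr_ge0 ?exprn_ge0 ?(ltW b0).
  have Tdiv : (Num.truncn (x * b%:R ^+ n.+1) %/ b)%N = T.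
    rewrite exprSr mulrA -/y.
    have /andP[Ty yT] := truncn_itv y0.
    have yb0 : 0 <= y * b%:R by rewrite mulr_ge0 ?(ltW b0).
    have /andP[Uy yU] := truncn_itv yb0.
    apply/eqP; rewrite eqn_leq -ltnS ltn_divLR ?(ltnW b1)// leq_divRL ?(ltnW b1)//.
    rewrite -(ltr_nat R) -[X in _ && X](ler_nat R); apply/andP; split.
      by rewrite natrM (le_lt_trans Uy)// ltr_pM2r.
    by rewrite ler_nat truncn_ge_nat// natrM ler_pM2r.
  rewrite /xdigit.
  rewrite [in RHS](divn_eq (Num.truncn (x * b%:R ^+ n.+1)) b) Tdiv natrD natrM mulrDl.
  by congr (_ + _); rewrite exprSr invfM -[RHS]mulrA [b%:R * _]mulrCA mulfV ?gt_eqF// mulr1.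
rewrite sE -[X in _ + X]mul1r -mulrDl natr1.
rewrite ler_pdivrMr ?ltr_pdivlMr ?exprn_gt0//.
by apply: truncn_itv; rewrite mulr_ge0 ?exprn_ge0 ?(ltW b0).
Qed.

(* the digits of k of index >= k vanish, as k < b ^ k *)
Definition wal1 (k : nat) (x : R) : R[i] :=
  let t := 2 * pi / b%:R *
    (\sum_(0 <= i < k) ((k %/ b ^ i) %% b) * xdigit i.+1 x)%:R in
  (cos t +i* sin t)%C.

Definition wal d (k : d.-tuple nat) (x : point R d) : R[i] :=
  \prod_(j < d) wal1 (tnth k j) (tnth x j).

Definition walsh_coef d (f : point R d -> R[i]) (k : d.-tuple nat) : R[i] :=
  cube_integral (fun x => f x * (wal k x)^*%C).

Definition supp d (k : d.-tuple nat) : {set 'I_d} :=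
  [set j | tnth k j != 0%N]%SET.

Definition rweight (alpha : R) (gamma : weights R) d (k : d.-tuple nat) : R :=
  (wt gamma (supp k))^-1 *
  \prod_(j in supp k) b%:R `^ (alpha * (trunc_log b (tnth k j))%:R).

Definition walsh_norm (alpha : R) (gamma : weights R) d
    (f : point R d -> R[i]) : \bar R :=
  ereal_sup [set (ComplexField.Normc.normc (walsh_coef f k) *
                  rweight alpha gamma k)%:E
            | k in [set: d.-tuple nat]].

(* The Walsh series is an unordered sum over N_0^d: convergence is along the
   finite sets of indices, directed by inclusion. *)
Definition walsh_represented d (f : point R d -> R[i]) : Prop :=
  forall x, cube_co x ->
    (fun A : {fset d.-tuple nat} =>
       ComplexField.Normc.normc (\sum_(k <- A) walsh_coef f k * wal k x - f x))
      @ totally --> (0 : R).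

Definition walsh_space (alpha : R) (gamma : weights R) d :
    set (point R d -> R[i]) :=
  [set f | [/\ square_integrable f, (walsh_norm alpha gamma f < +oo)%E &
               walsh_represented f]].

Definition worst_case_error (m : nat) (p : {poly 'F_b}) (alpha : R)
    (gamma : weights R) d (g : d.-tuple {poly 'F_b}) : \bar R :=
  ereal_sup [set (ComplexField.Normc.normc (qmc_rule m p g f - cube_integral f))%:E
            | f in [set f | walsh_space alpha gamma f /\
                            (walsh_norm alpha gamma f <= 1)%E]].

Definition walsh_mu (alpha : R) : R :=
  limn (fun n => \sum_(1 <= k < n) b%:R `^ (- (alpha * (trunc_log b k)%:R))).

End walsh.

(** * Component-by-component construction *)

Section cbc.
Variables (R : realType) (b m : nat) (eta : weights R) (p : {poly 'F_b}).

Definition floor_log (x : R) : int := Num.floor (ln x / ln b%:R).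

Definition log_prod s (u : {set 'I_s}) (x : 'I_s -> R) : R :=
  \prod_(j in u) ((1 - b%:R) * (floor_log (x j))%:~R - b%:R).

Definition Kfun (gs : seq {poly 'F_b}) : R :=
  \sum_(u : {set 'I_(size gs)} | u != finset.set0) wt eta u *
    \sum_(1 <= n < b ^ m)
      log_prod u (fun j => vmap R m (laurent (nat_poly b n * gs`_j) p)).

(* g is a possible output of the algorithm: the choice among several minimizers
   is left open. *)
Definition cbc_output d (g : d.-tuple {poly 'F_b}) : Prop :=
  g`_0 = 1 /\
  forall s, (0 < s < d)%N ->
    g`_s \in Gstar b m /\
    forall h, h \in Gstar b m ->
      Kfun (rcons (take s g) g`_s) <= Kfun (rcons (take s g) h).

End cbc.

(* Main.v *)
(* Write N = b^m.  By character orthogonality the rule integrates a Walsh function wal_k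
   to 1 or 0 according to whether k lies in the dual set of the lattice, and on
   nonzero lattice points each factor of L_u is the Walsh polynomial
   sum_{1 <= k < N} b^(-floor(log_b k)) wal_k.  Hence K is N times the weighted sum T
   of prod_j b^(-floor(log_b k_j)) over the nonzero dual vectors in [0, N)^d, minus a
   quantity not depending on g.  Averaging over the last component bounds (N - 1) T by
   the sum over all vectors, which is at most gamma_0 prod_j (1 + Gamma_j (b - 1) m)
   with summable Gamma_j, hence O(N^delta).  The worst-case error is at most the sum
   of the alpha-th powers over all nonzero dual vectors: inside the box it is at most
   T^alpha, and outside it, replacing an entry k_j >= N by floor(k_j / N) is injective
   on dual vectors, because the other entries determine k_j mod N, and gains a factor
   N^(-alpha).  The second statement is the first one
   for the weights gamma^(1/alpha). *)

Require Import Defs.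
From HB Require Import structures.
From mathcomp Require Import all_boot all_order all_algebra finmap complex.
From mathcomp Require Import all_classical all_reals all_analysis summability.
From mathcomp Require Import ring lra zify.

Set Implicit Arguments.
Unset Strict Implicit.
Unset Printing Implicit Defensive.

Import Order.TTheory GRing.Theory Num.Theory.
Import numFieldNormedType.Exports.

Local Open Scope classical_set_scope.
Local Open Scope ring_scope.

(** * Additive characters of the prime field *)

Lemma prime_gt0r (R : realType) (b : nat) : prime b -> 0 < b%:R :> R.
Proof. by move=> /prime_gt0; rewrite ltr0n. Qed.

(** The root of unity e^(2 pi i n / b), at a natural argument so that values of [wal1] are
    convertible to values of [cexp]. *)
Definition cexp (R : realType) (b n : nat) : R[i] :=
  (cos (2 * pi / b%:R * n%:R) +i* sin (2 * pi / b%:R * n%:R))%C.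

Lemma cexp0 (R : realType) b : cexp R b 0 = 1.
Proof. by rewrite /cexp mulr0 cos0 sin0. Qed.

Lemma cexpD (R : realType) b n n' : cexp R b (n + n') = cexp R b n * cexp R b n'.
Proof.
rewrite /cexp natrD mulrDr cosD sinD; apply/eqP; rewrite eq_complex/=.
by apply/andP; split; apply/eqP => //; rewrite addrC [X in _ + X]mulrC [in RHS]addrC mulrC addrC.
Qed.

Lemma cexp_period (R : realType) b : prime b -> cexp R b b = 1.
Proof.
move=> /(prime_gt0r R) b0; rewrite /cexp divfK ?gt_eqF//.
by rewrite mulr_natl cos2pi sin2pi.
Qed.

Lemma cexp_mod (R : realType) b n : prime b -> cexp R b (n %% b) = cexp R b n.
Proof.
move=> pb; rewrite [in RHS](divn_eq n b) cexpD.
suff -> : cexp R b (n %/ b * b) = 1 by rewrite mul1r.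
elim: (n %/ b)%N => [|q IH]; first by rewrite mul0n cexp0.
by rewrite mulSn cexpD IH cexp_period// mulr1.
Qed.

Definition chi (R : realType) (b : nat) (a : 'F_b) : R[i] := cexp R b a.

Lemma chi_nat (R : realType) b n : prime b -> chi R (n%:R : 'F_b) = cexp R b n.
Proof. by move=> pb; rewrite /chi val_Fp_nat ?cexp_mod. Qed.

Lemma chi0 (R : realType) b : chi R (0 : 'F_b) = 1.
Proof. by rewrite /chi cexp0. Qed.

Lemma chiD (R : realType) b (x y : 'F_b) : prime b ->
  chi R (x + y) = chi R x * chi R y.
Proof.
move=> pb; rewrite -[in LHS](natr_Zp x) -[in LHS](natr_Zp y) -natrD chi_nat//.
by rewrite cexpD.
Qed.

Lemma chi_sum (R : realType) b (I : Type) (r : seq I) (P : pred I) (F : I -> 'F_b) :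
  prime b -> chi R (\sum_(i <- r | P i) F i) = \prod_(i <- r | P i) chi R (F i).
Proof. by move=> pb; apply: big_morph => [x y|]; rewrite ?chi0 ?chiD. Qed.

(** With t = pi x / b strictly between 0 and pi, the real part is cos(2t), which is below 1 because
    sin t > 0. *)
Lemma chi_neq1 (R : realType) b (x : 'F_b) : prime b -> x != 0 -> chi R x != 1.
Proof.
move=> pb x0; rewrite /chi /cexp eq_complex /= negb_and; apply/orP; left.
have b0 := prime_gt0r R pb.
have xb : (x < b)%N by rewrite -[X in (_ < X)%N](Fp_cast pb) ltn_ord.
have xp : (0 < x)%N by rewrite lt0n.
pose t : R := pi / b%:R * (x : nat)%:R.
have -> : 2 * pi / b%:R * (x : nat)%:R = t *+ 2.
  by rewrite -[t *+ 2]mulr_natl /t !mulrA.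
rewrite cos_mulr2n -subr_eq0 -addrA -opprD -[1 + 1]/(2%:R) subr_eq0.
have t0 : 0 < t by rewrite mulr_gt0 ?divr_gt0 ?pi_gt0// ltr0n.
have tpi : t < pi.
  by rewrite /t mulrAC ltr_pdivrMr// ltr_pM2l ?pi_gt0// ltr_nat.
have s0 : 0 < sin t by rewrite sin_gt0_pi// t0.
have cs := cos2Dsin2 t.
have s2 : 0 < sin t ^+ 2 by rewrite exprn_gt0.
by rewrite lt_eqF//; lra.
Qed.

(** If [phi v0] is nonzero, translating the summation by [v0] multiplies the sum by
    [chi R (phi v0)], which is not 1, so the sum vanishes. *)
Lemma sum_chi_morph (R : realType) b (V : finZmodType) (phi : V -> 'F_b) :
  prime b -> {morph phi : x y / x + y} ->
  \sum_(v : V) chi R (phi v) = if [forall v, phi v == 0] then (#|V|)%:R else 0.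
Proof.
move=> pb phiD; case: ifPn => [/forallP phi0|].
  rewrite (eq_bigr (fun=> 1)) => [|v _]; last by rewrite (eqP (phi0 v)) chi0.
  by rewrite sumr_const.
rewrite negb_forall => /existsP[v0 phiv0].
set S := \sum_v _.
have : S = chi R (phi v0) * S.
  rewrite {1}/S (reindex_inj (addrI v0)) mulr_sumr.
  by apply: eq_bigr => v _; rewrite phiD chiD.
move=> /eqP; rewrite -subr_eq0 -{1}[S]mul1r -mulrBl mulf_eq0 => /orP[|/eqP//].
by rewrite subr_eq0 eq_sym (negbTE (chi_neq1 R pb phiv0)).
Qed.

(** * Base-b digits of lattice coordinates *)

(** Digits are at most b - 1, and (b - 1) b^(-l) telescopes. Finiteness of the sum keeps it strictly
    below b^(-i), so no carry reaches the first i digits. *)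
Lemma sum_digits_tail (R : realType) (b : nat) (t : nat -> nat) i k :
  (1 < b)%N -> (forall l, (t l < b)%N) ->
  \sum_(i.+1 <= l < (i + k).+1) (t l)%:R * b%:R ^- l <= b%:R ^- i - b%:R ^- (i + k) :> R.
Proof.
move=> b1 tb; have b0 : 0 < b%:R :> R by rewrite ltr0n ltnW.
elim: k => [|k IH]; first by rewrite addn0 big_geq// subrr.
rewrite addnS big_nat_recr/= ?ltnS ?leq_addr//.
have E : b%:R ^- (i + k)%N = b%:R * b%:R ^- (i + k).+1 :> R.
  by rewrite exprS invfM mulrA mulfV ?mul1r ?gt_eqF.
apply: le_trans (lerD IH (_ : _ <= (b%:R - 1) * b%:R ^- (i + k).+1)) _.
  rewrite ler_wpM2r ?invr_ge0 ?exprn_ge0 ?(ltW b0)//.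
  by rewrite lerBrDr natr1 ler_nat.
by rewrite E mulrBl mul1r; lra.
Qed.

Lemma xdigit_sum (R : realType) (b : nat) (t : nat -> nat) n i :
  (1 < b)%N -> (forall l, (t l < b)%N) -> (0 < i <= n)%N ->
  xdigit b i (\sum_(1 <= l < n.+1) (t l)%:R * b%:R ^- l : R) = t i.
Proof.
move=> b1 tb /andP[i0 ile].
have b0 : 0 < b%:R :> R by rewrite ltr0n ltnW.
pose s n : R := \sum_(1 <= l < n.+1) (t l)%:R * b%:R ^- l.
(* [A n] is the integer with base-b digits t 1, ..., t n. Multiplying by b^i and truncating leaves
   [A i], whose last digit is t i. *)
pose A := fix A n := if n is n'.+1 then (A n' * b + t n)%N else 0%N.
have sA n' : s n' * b%:R ^+ n' = (A n')%:R.
  elim: n' => [|n' IH]; first by rewrite /s big_nil mul0r.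
  rewrite /s big_nat_recr//= -/(s n') mulrDl -mulrA mulVf ?expf_neq0 ?gt_eqF//.
  by rewrite mulr1 exprSr mulrA IH natrD natrM.
have bound k : 0 <= s (i + k)%N - s i <= b%:R ^- i - b%:R ^- (i + k)%N.
  have -> : s (i + k)%N = s i + \sum_(i.+1 <= l < (i + k).+1) (t l)%:R * b%:R ^- l.
    by rewrite /s (big_cat_nat (n := i.+1))//= ltnS leq_addr.
  rewrite addrAC subrr add0r.
  by rewrite sum_digits_tail// sumr_ge0// => l _; rewrite mulr_ge0// invr_ge0 exprn_ge0// ltW.
have := bound (n - i)%N; rewrite subnKC// => /andP[B0 B1].
have bi : 0 < b%:R ^+ i :> R by rewrite exprn_gt0.
have trE : Num.truncn (s n * b%:R ^+ i) = A i.
  apply: truncn_def; rewrite -sA -natr1 -sA; apply/andP; split.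
    by rewrite ler_pM2r// -subr_ge0.
  rewrite -ltrBlDl -mulrBl -ltr_pdivlMr// mul1r.
  by apply: le_lt_trans B1 _; rewrite ltrBlDl ltrDr invr_gt0 exprn_gt0.
rewrite /xdigit -/(s n) trE; case: i i0 {ile bound B0 B1 bi trE} => // i _ /=.
by rewrite modnMDl modn_small.
Qed.

Lemma xdigit_vmap (R : realType) (b m : nat) (t : int -> 'F_b) i : prime b ->
  xdigit b i.+1 (vmap R m t) = (if (i < m)%N then t i.+1 else 0).
Proof.
move=> pb; have b1 := prime_gt1 pb.
(* Padding with zeros beyond m gives one expansion long enough to contain index i + 1, whether or
   not i < m. *)
pose t' l : nat := if (l <= m)%N then (t l%:Z : nat) else 0%N.
have -> : vmap R m t = \sum_(1 <= l < (m + i.+1).+1) (t' l)%:R * b%:R ^- l.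
  rewrite [RHS](big_cat_nat (n := m.+1))//=; last by rewrite ltnS leq_addr.
  rewrite [X in _ + X]big_nat_cond [X in _ + X]big1 ?addr0 => [|l]; last first.
    by rewrite andbT /t' => /andP[ml _]; rewrite leqNgt ml mul0r.
  by apply: eq_big_nat => l /andP[_]; rewrite ltnS /t' => ->.
rewrite xdigit_sum ?leq_addl// /t'; first by case: ifP.
by move=> l; case: ifP => _; rewrite ?(ltnW b1)// -[X in (_ < X)%N](Fp_cast pb) ltn_ord.
Qed.

(** * Digit vectors, Laurent vectors and their pairing *)

(** The first m base-b digits of k: the quotients are reduced modulo b by the cast to ['F_b]. Only k
    mod b^m is recorded. *)
Definition dig (b m k : nat) : 'rV['F_b]_m := \row_(i < m) (k %/ b ^ i)%:R.

Definition lau (b m : nat) (p q : {poly 'F_b}) : 'rV['F_b]_m :=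
  \row_(i < m) laurent q p (i.+1)%:Z.

Definition dotp (F : nzRingType) m (u v : 'rV[F]_m) : F := \sum_i u 0 i * v 0 i.

Lemma dotp0l (F : nzRingType) m (v : 'rV[F]_m) : dotp 0 v = 0.
Proof. by rewrite /dotp big1// => i _; rewrite mxE mul0r. Qed.

Lemma dotpDr (F : nzRingType) m (u v w : 'rV[F]_m) :
  dotp u (v + w) = dotp u v + dotp u w.
Proof. by rewrite /dotp -big_split; apply: eq_bigr => i _; rewrite mxE mulrDr. Qed.

Lemma dotpBr (F : nzRingType) m (u v w : 'rV[F]_m) :
  dotp u (v - w) = dotp u v - dotp u w.
Proof. by rewrite /dotp -sumrB; apply: eq_bigr => i _; rewrite !mxE mulrBr. Qed.

Lemma dig0 b m : dig b m 0 = 0.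
Proof. by apply/rowP => i; rewrite !mxE div0n. Qed.

Lemma dig_mod b m k : prime b -> dig b m (k %% b ^ m) = dig b m k.
Proof.
move=> pb; apply/rowP => i; rewrite !mxE.
have b0 := prime_gt0 pb.
rewrite [in RHS](divn_eq k (b ^ m)).
have -> : (b ^ m = b ^ (m - i) * b ^ i)%N by rewrite -expnD subnK// ltnW.
rewrite mulnA divnMDl ?expn_gt0 ?b0// natrD natrM natrX.
have : (0 < m - i)%N by rewrite subn_gt0.
case: (m - i)%N => // j _; rewrite exprS.
have -> : (b%:R : 'F_b) = 0 by rewrite -[X in X%:R](pdiv_id pb) pchar_Zp// prime_gt1// pdiv_prime// prime_gt1.
by rewrite mul0r mulr0 add0r.
Qed.

Lemma dig_inj b m k l : prime b -> (k < b ^ m)%N -> (l < b ^ m)%N ->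
  dig b m k = dig b m l -> k = l.
Proof.
move=> pb; have b0 := prime_gt0 pb.
elim: m k l => [|m IH] k l; first by rewrite !ltnS !leqn0 => /eqP -> /eqP ->.
rewrite expnSr => km lm /rowP E.
rewrite (divn_eq k b) (divn_eq l b); congr (_ * _ + _)%N.
  apply: IH; rewrite ?ltn_divLR//; apply/rowP => i; rewrite !mxE -!divnMA -expnS.
  by have := E (lift ord0 i); rewrite !mxE.
have := E ord0; rewrite !mxE expn0 !divn1 => /(congr1 (fun x : 'F_b => x : nat)).
by rewrite !val_Fp_nat.
Qed.

(** Rewrites Walsh values at lattice coordinates as characters of a bilinear pairing, the form in
    which orthogonality applies. *)
Lemma wal1_vmap (R : realType) (b m k : nat) (p q : {poly 'F_b}) : prime b ->
  wal1 b k (vmap R m (laurent q p)) = chi R (dotp (dig b m k) (lau m p q)).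
Proof.
move=> pb; set x := vmap _ _ _.
transitivity (cexp R b (\sum_(0 <= i < k) ((k %/ b ^ i) %% b) * xdigit b i.+1 x)) => //.
rewrite -chi_nat//; congr chi; rewrite natr_sum.
(* [G i] vanishes for i >= m and for i >= k, so the sums over m and over k indices both equal the
   sum over m + k indices. *)
pose G i : 'F_b := (k %/ b ^ i)%:R * (if (i < m)%N then laurent q p i.+1 else 0).
have -> : dotp (dig b m k) (lau m p q) = \sum_(0 <= i < m) G i.
  by rewrite big_mkord /dotp; apply: eq_bigr => i _; rewrite !mxE /G ltn_ord.
have -> : \sum_(0 <= i < m) G i = \sum_(0 <= i < m + k) G i.
  rewrite [RHS](big_cat_nat (n := m))//= ?leq_addr// [X in _ + X]big_nat_cond.
  by rewrite [X in _ + X]big1 ?addr0// => i /andP[/andP[mi _] _]; rewrite /G ltnNge mi mulr0.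
transitivity (\sum_(0 <= i < k) G i).
  apply: eq_bigr => i _; rewrite natrM xdigit_vmap// /G; congr (_ * _).
    by apply: val_inj; rewrite /= !val_Fp_nat// modn_mod.
  by case: ifP => // _; rewrite natr_Zp.
rewrite [RHS](big_cat_nat (n := k))//= ?leq_addl// [X in _ + X]big_nat_cond.
rewrite [X in _ + X]big1 ?addr0// => i /andP[/andP[ki _] _]; rewrite /G divn_small ?mul0r//.
by apply: leq_ltn_trans ki _; rewrite ltn_expl// prime_gt1.
Qed.

Lemma laurent_pos_mod (F : fieldType) (p q : {poly F}) n : p != 0 ->
  laurent q p n.+1 = laurent (q %% p) p n.+1.
Proof.
move=> p0; rewrite /= {1}(divp_eq q p) mulrDl divpD mulrAC mulpK// coefD coefMXn/=.
by rewrite add0r.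
Qed.

Lemma lauD b m (p q r : {poly 'F_b}) : lau m p (q + r) = lau m p q + lau m p r.
Proof. by apply/rowP => i; rewrite !mxE /= mulrDl divpD coefD. Qed.

Lemma lauB b m (p q r : {poly 'F_b}) : lau m p (q - r) = lau m p q - lau m p r.
Proof. by rewrite -[in RHS](subrK r q) [in RHS]lauD addrK. Qed.

(** Let r be the remainder of q modulo p. By [laurentP] each coefficient of r is a combination of
    Laurent coefficients of r / p at x^(-l) with l <= m. Those with l >= 1 vanish by assumption, the
    others because deg r < deg p. *)
Lemma lau_eq0_dvdp b m (p q : {poly 'F_b}) : size p = m.+1 -> lau m p q = 0 -> p %| q.
Proof.
move=> sp /rowP E.
have p0 : p != 0 by rewrite -size_poly_gt0 sp.
have {E} E i : (i < m)%N -> laurent (q %% p) p i.+1 = 0.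
  by move=> im; have := E (Ordinal im); rewrite !mxE laurent_pos_mod.
set r := q %% p in E *.
have sr : (size r <= m)%N by rewrite -ltnS -sp ltn_modp.
rewrite -[p %| q]/(r == 0); apply/eqP/polyP => k; rewrite coef0.
have [mk|km] := leqP m k; first by rewrite nth_default// (leq_trans sr).
have := laurentP r (- k%:Z) p0; rewrite oppr_le0 /= abszN absz_nat => <-.
rewrite big1// => i _.
have : (i <= m)%N by rewrite -ltnS -sp.
case lE : (- k%:Z + i%:Z)%R => [[|l]|l] im.
- by rewrite /= expr0 mulr1 divp_small ?coef0 ?mulr0// ltn_modp.
- by rewrite E ?mulr0//; lia.
- by rewrite /= divp_small ?coef0 ?mulr0// ltn_modp.
Qed.

Section nondegenerate.
Variables (b m : nat) (p : {poly 'F_b}).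
Hypotheses (p_irr : irreducible_poly p) (size_p : size p = m.+1).

(** Equal images make p divide the product of g with a difference of degree below m. As p is
    irreducible and prime to g, that difference is 0. *)
Lemma lau_mul_inj (g : {poly 'F_b}) : ~~ (p %| g) ->
  injective (fun v : 'rV_m => lau m p (rVpoly v * g)).
Proof.
move=> pg v w /= /eqP; rewrite -subr_eq0 -lauB -mulrBl -raddfB/= => /eqP.
move=> /(lau_eq0_dvdp size_p); 
rewrite mulrC Gauss_dvdpr ?irreducible_poly_coprime// => pvw.
apply/eqP; rewrite -subr_eq0; apply/eqP/(can_inj rVpolyK); rewrite raddf0.
apply/eqP; apply: contraTT pvw => vw0; rewrite gtNdvdp//.
by rewrite size_p ltnS size_poly.
Qed.

(** An injective self-map of a finite set is onto, so every unit vector is a Laurent vector of this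
    form, and pairing with it reads off an entry of u. *)
Lemma dotp_lau_nondegenerate (g : {poly 'F_b}) (u : 'rV_m) : ~~ (p %| g) ->
  (forall v : 'rV_m, dotp u (lau m p (rVpoly v * g)) = 0) -> u = 0.
Proof.
move=> pg u0; have [f fK Kf] := injF_bij (lau_mul_inj pg).
apply/rowP => i; have := u0 (f (delta_mx 0 i)); rewrite Kf /dotp (bigD1 i)//= big1.
  by rewrite !mxE !eqxx mulr1 addr0.
by move=> j ji; rewrite !mxE (negbTE ji) andbF mulr0.
Qed.

Lemma Gstar_ndvdp (g : {poly 'F_b}) : g \in Gstar b m -> ~~ (p %| g).
Proof. by move=> /andP[g0 sg]; rewrite gtNdvdp// size_p ltnS. Qed.

End nondegenerate.

(** * The dual set and character orthogonality *)

Lemma nat_poly_dig b m n : prime b -> (n < b ^ m)%N ->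
  nat_poly b n = rVpoly (dig b m n).
Proof.
move=> pb nm; have b1 := prime_gt1 pb; apply/polyP => k; rewrite coef_poly coef_rVpoly.
have big0 j : (n < b ^ j)%N -> ((n %/ b ^ j) %% b)%:R = 0 :> 'F_b.
  by move=> nj; rewrite divn_small// mod0n.
case: insubP => [i km ik|]; last first.
  rewrite -leqNgt => mk; case: ifP => // _; rewrite big0//.
  by rewrite (leq_trans nm)// leq_exp2l.
rewrite mxE ik; case: ifP => [_|/negbT].
  by apply: val_inj; rewrite /= !val_Fp_nat// modn_mod.
rewrite -leqNgt => nk; rewrite divn_small//.
by apply: leq_ltn_trans (ltnW nk) _; rewrite ltn_expl.
Qed.

Lemma sum_dig b m (V : nmodType) (F : 'rV['F_b]_m -> V) : prime b ->
  \sum_(0 <= n < b ^ m) F (dig b m n) = \sum_v F v.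
Proof.
move=> pb; rewrite big_mkord [RHS](reindex (fun n : 'I_(b ^ m) => dig b m n))//.
apply: onW_bij; apply: inj_card_bij => [x y /dig_inj xy|].
  by apply: val_inj; apply: xy.
by rewrite card_mx mul1n card_Fp// card_ord.
Qed.

(** Duality in character form: the phase of wal_k is trivial at every lattice point. This replaces a
    congruence modulo p. Through [dig], entries of k count only modulo b^m. *)
Definition dual (b m : nat) (p : {poly 'F_b}) d (g : 'I_d -> {poly 'F_b})
    (k : 'I_d -> nat) : bool :=
  [forall v : 'rV_m, \sum_j dotp (dig b m (k j)) (lau m p (rVpoly v * g j)) == 0].

(** As n runs over [0, b^m), its digit vector runs over all vectors and the total phase [phi] is
    additive in it, so [sum_chi_morph] applies. *)
Lemma sum_prod_wal1_dual (R : realType) b m p d (g : 'I_d -> {poly 'F_b}) (k : 'I_d -> nat) :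
  prime b ->
  \sum_(0 <= n < b ^ m)
    \prod_j wal1 b (k j) (vmap R m (laurent (nat_poly b n * g j) p)) =
  if dual m p g k then (b ^ m)%:R else 0.
Proof.
move=> pb.
pose phi (v : 'rV_m) : 'F_b := \sum_j dotp (dig b m (k j)) (lau m p (rVpoly v * g j)).
transitivity (\sum_(0 <= n < b ^ m) chi R (phi (dig b m n))).
  apply: eq_big_nat => n /andP[_ nm]; rewrite (nat_poly_dig pb nm) chi_sum//.
  by apply: eq_bigr => j _; rewrite wal1_vmap.
rewrite (sum_dig (fun v => chi R (phi v)))// sum_chi_morph//.
  by rewrite card_mx mul1n card_Fp.
move=> v w; rewrite /phi -big_split; apply: eq_bigr => j _.
by rewrite raddfD/= mulrDl lauD dotpDr.
Qed.

(** For k < b^n only the first n digits can be nonzero, so this is a complete character sum over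
    vectors of length n. *)
Lemma sum_digit_char (R : realType) (b m : nat) (u : 'rV['F_b]_m) n : prime b ->
  (n <= m)%N ->
  \sum_(0 <= k < b ^ n) chi R (dotp (dig b m k) u) =
  if [forall i : 'I_m, (i < n)%N ==> (u 0 i == 0)] then (b ^ n)%:R else 0.
Proof.
move=> pb nm; pose w i := widen_ord nm i.
pose phi (v : 'rV_n) : 'F_b := \sum_(i < n) v 0 i * u 0 (w i).
transitivity (\sum_(0 <= k < b ^ n) chi R (phi (dig b n k))).
  apply: eq_big_nat => k /andP[_ kn]; congr chi.
  rewrite /dotp (bigID (fun i : 'I_m => (i < n)%N))/= [X in _ + X]big1 ?addr0.
    by rewrite (big_ord_narrow nm); apply: eq_bigr => i _; rewrite !mxE.
  move=> i; rewrite -leqNgt => ni; rewrite !mxE divn_small ?mul0r//.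
  by rewrite (leq_trans kn)// leq_exp2l// prime_gt1.
rewrite (sum_dig (fun v => chi R (phi v)))// sum_chi_morph//; last first.
  by move=> x y; rewrite /phi -big_split; apply: eq_bigr => i _; rewrite mxE mulrDl.
rewrite card_mx mul1n card_Fp//; congr (if _ then _ else _).
apply/forallP/forallP => [h i|h v].
  apply/implyP => ilt; have := h (delta_mx 0 (Ordinal ilt)).
  rewrite /phi (bigD1 (Ordinal ilt))//= big1 ?addr0 => [|j jlt].
    by rewrite mxE !eqxx mul1r (_ : w _ = i)//; exact: val_inj.
  by rewrite mxE (negbTE jlt) andbF mul0r.
apply/eqP; rewrite /phi big1// => i _.
by have /implyP/(_ (ltn_ord i))/eqP -> := h (w i); rewrite mulr0.
Qed.

(** * Walsh expansion of the logarithmic factor *)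

(** Group k by its logarithm n. Each block is b^(-n) times the difference of the complete sums up to
    b^(n+1) and b^n, and these equal b^n up to n = i0 and 0 afterwards. The blocks thus give b - 1
    for n < i0, then -1 at n = i0, then 0. *)
Lemma sum_log_char (R : realType) (b m : nat) (u : 'rV['F_b]_m) (i0 : 'I_m) :
  prime b -> u 0 i0 != 0 -> (forall i : 'I_m, (i < i0)%N -> u 0 i = 0) ->
  \sum_(1 <= k < b ^ m) (b%:R ^- trunc_log b k) * chi R (dotp (dig b m k) u) =
  (b%:R - 1) * (i0 : nat)%:R - 1.
Proof.
move=> pb ui0 ultz; have b1 := prime_gt1 pb.
have b0 : b%:R != 0 :> R[i] by rewrite pnatr_eq0 -lt0n prime_gt0.
pose S n := \sum_(1 <= k < b ^ n) (b%:R ^- trunc_log b k) * chi R (dotp (dig b m k) u).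
have DE n : (n <= m)%N -> \sum_(0 <= k < b ^ n) chi R (dotp (dig b m k) u) =
    if (n <= i0)%N then b%:R ^+ n else 0.
  move=> nm; rewrite sum_digit_char// natrX; congr (if _ then _ else _).
  apply/forallP/idP => [h|ni i]; last first.
    by apply/implyP => ilt; rewrite ultz ?(leq_trans ilt).
  rewrite leqNgt; apply/negP => lt; move: ui0.
  by have /implyP/(_ lt)/eqP -> := h i0; rewrite eqxx.
have SS n : S n.+1 = S n + b%:R ^- n *
    (\sum_(0 <= k < b ^ n.+1) chi R (dotp (dig b m k) u) -
     \sum_(0 <= k < b ^ n) chi R (dotp (dig b m k) u)).
  have le1 : (b ^ n <= b ^ n.+1)%N by rewrite leq_exp2l.
  rewrite /S (big_cat_nat (n := b ^ n))//= ?expn_gt0 ?prime_gt0//; congr (_ + _).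
  rewrite [X in X - _](big_cat_nat (n := b ^ n))//= addrAC subrr add0r mulr_sumr.
  by apply: eq_big_nat => k /(trunc_log_eq b1) ->.
suff H n : (n <= m)%N -> S n = if (n <= i0)%N then (b%:R - 1) * n%:R
                               else (b%:R - 1) * (i0 : nat)%:R - 1.
  by rewrite -/(S m) H// leqNgt ltn_ord.
elim: n => [|n IH] nm; first by rewrite /S expn0 big_geq// mulr0.
rewrite (SS n) (IH (ltnW nm)) (DE n.+1 nm) (DE n (ltnW nm)).
have bn0 : b%:R ^+ n != 0 :> R[i] by rewrite expf_neq0.
have [ni|ni|ni] := ltngtP n i0.
- by rewrite -natr1 exprS; field.
- by rewrite subrr mulr0 addr0.
- by rewrite sub0r mulrN mulVf// -ni.
Qed.

(** The first nonzero digit at position i0 + 1 places the point in [b^(-i0-1), b^(-i0)). *)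
Lemma floor_log_vmap (R : realType) (b m : nat) (t : int -> 'F_b) (i0 : 'I_m) :
  prime b -> t i0.+1 != 0 -> (forall i, (i < i0)%N -> t i.+1 = 0) ->
  floor_log b (vmap R m t) = - (i0.+1)%:Z.
Proof.
move=> pb ti0 tz; have b1 := prime_gt1 pb.
have b0 : 0 < b%:R :> R by rewrite ltr0n ltnW.
have tb l : ((t l%:Z : nat) < b)%N by rewrite -[X in (_ < X)%N](Fp_cast pb) ltn_ord.
have lnb : 0 < ln b%:R :> R by rewrite ln_gt0// ltr1n.
set x := vmap R m t.
have xE : x = \sum_(i0.+1 <= l < m.+1) (t l%:Z : nat)%:R * b%:R ^- l.
  rewrite /x /vmap (big_cat_nat (n := i0.+1))//= 1?ltnW ?ltnS//.
  rewrite [X in X + _]big_nat_cond big1 ?add0r// => -[|l]//.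
  by rewrite ltnS => /andP[li _]; rewrite tz// mul0r.
have term0 l : 0 <= (t l%:Z : nat)%:R * b%:R ^- l :> R.
  by rewrite mulr_ge0// invr_ge0 exprn_ge0// ltW.
have xlb : b%:R ^- i0.+1 <= x.
  rewrite xE big_nat_recl// ?ltn_ord// ler_wpDr ?sumr_ge0//.
  rewrite ler_peMl ?invr_ge0 ?exprn_ge0 ?(ltW b0)// ler1n lt0n.
  by apply: contra ti0 => /eqP t0; apply/eqP/val_inj.
have xub : x < b%:R ^- i0.
  rewrite xE; have := sum_digits_tail R i0 (m - i0) b1 tb.
  rewrite subnKC 1?ltnW// => /le_lt_trans; apply.
  by rewrite ltrBlDr ltrDl invr_gt0 exprn_gt0.
have x0 : 0 < x by apply: lt_le_trans xlb; rewrite invr_gt0 exprn_gt0.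
apply: floor_def; rewrite ler_pdivlMr// ltr_pdivrMr//.
have lnE n : ln (b%:R ^- n) = (- n%:Z)%:~R * ln b%:R :> R.
  by rewrite lnV ?posrE ?exprn_gt0// lnXn// mulrNz mulNr mulr_natl.
rewrite (_ : - (i0.+1)%:Z + 1 = - (i0 : nat)%:Z); last by lia.
rewrite -!lnE ler_ln ?posrE ?invr_gt0 ?exprn_gt0// xlb/=.
by rewrite ltr_ln ?posrE ?invr_gt0 ?exprn_gt0.
Qed.

(** Both sides depend only on the index i0 of the first nonzero entry of the Laurent vector, since
    (1 - b)(-(i0 + 1)) - b = (b - 1) i0 - 1. *)
Lemma log_factor_walsh (R : realType) (b m : nat) (p q : {poly 'F_b}) :
  prime b -> lau m p q != 0 ->
  ((1 - b%:R) * (floor_log b (vmap R m (laurent q p)))%:~R - b%:R : R)%:C%C =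
  \sum_(1 <= k < b ^ m) (b%:R ^- trunc_log b k)%:C%C * wal1 b k (vmap R m (laurent q p)).
Proof.
move=> pb u0; set u := lau m p q in u0.
have [i1 ui1] : exists i, u 0 i != 0.
  apply/existsP; apply: contraR u0; rewrite negb_exists => /forallP u0.
  by apply/eqP/rowP => i; rewrite !mxE; have := u0 i; rewrite negbK mxE => /eqP.
case: (@arg_minnP _ i1 (fun i => u 0 i != 0) (fun i : 'I_m => i : nat) ui1) => i0 ui0 imin.
have uz (i : 'I_m) : (i < i0)%N -> u 0 i = 0.
  by move=> ii; apply/eqP; apply: contraTT ii => /imin; rewrite -leqNgt.
rewrite (@floor_log_vmap R b m (laurent q p) i0)//; first last.
- move=> i ii; have im := ltn_trans ii (ltn_ord i0).
  by have := uz (Ordinal im) ii; rewrite mxE.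
- by move: ui0; rewrite mxE.
transitivity ((b%:R - 1) * (i0 : nat)%:R - 1 : R[i]).
  rewrite -(rmorph_nat (real_complex R) b) -(rmorph_nat (real_complex R) i0).
  rewrite -(rmorph1 (real_complex R)) -rmorphB -rmorphM -rmorphB; congr (_%:C%C).
  by rewrite mulrNz -pmulrn -natr1; ring.
rewrite -(sum_log_char R pb ui0 uz); apply: eq_bigr => k _.
by rewrite wal1_vmap// fmorphV rmorphXn rmorph_nat.
Qed.

(** * The criterion K as a sum over dual vectors *)

Definition fsupp d n (k : {ffun 'I_d -> 'I_n}) : {set 'I_d} :=
  [set j | (k j : nat) != 0%N]%SET.

Definition below d s : {set 'I_d} := [set j : 'I_d | (j < s)%N]%SET.

(** Expanding the product chooses a nonzero entry for each j in u; filling the remaining places with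
    0 turns the choices into the vectors with support exactly u. *)
Lemma prod_sum_fsupp (A : comPzRingType) d n (u : {set 'I_d}) (f : 'I_d -> nat -> A) :
  (0 < n)%N ->
  \prod_(j in u) \sum_(1 <= k < n) f j k =
  \sum_(k : {ffun 'I_d -> 'I_n} | fsupp k == u) \prod_(j in u) f j (k j).
Proof.
move=> n0; pose o := Ordinal n0.
transitivity (\prod_(j in u) \sum_(k : 'I_n | k != o) f j k).
  apply: eq_bigr => j _; rewrite -(big_mkord (fun k => k != 0%N) (f j)).
  rewrite big_ltn_cond//= [LHS]big_nat_cond [RHS]big_nat_cond.
  by apply: eq_bigl => -[|k]; rewrite ?andbF ?andbT.
rewrite (big_distr_big o); apply: eq_bigl => k.
apply/pfamilyP/eqP => [[/fintype.subsetP su kin]|<-].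
  apply/setP => j; rewrite inE; apply/idP/idP => [kj|ju].
    by apply: su; rewrite inE.
  by have := kin j ju; rewrite unfold_in/=.
split=> [|j]; last by rewrite inE unfold_in.
by apply/fintype.subsetP => j; rewrite !inE.
Qed.

(** The product may run over all j: a zero entry contributes 1, because [trunc_log b 0] is 0. *)
Definition walsh_weight (R : realType) (b : nat) (gamma : weights R) d n
    (k : {ffun 'I_d -> 'I_n}) : R :=
  wt gamma (fsupp k) * \prod_j b%:R ^- trunc_log b (k j).

Definition log_factor (R : realType) (b m : nat) (p g : {poly 'F_b}) (n : nat) : R :=
  (1 - b%:R) * (floor_log b (vmap R m (laurent (nat_poly b n * g) p)))%:~R - b%:R.

(** The criterion K for the first s components, with all index sets inside ['I_d] so that successive
    stages can be compared. *)
Definition Kpart (R : realType) (b m : nat) (gamma : weights R) (p : {poly 'F_b}) d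
    (s : nat) (g : 'I_d -> {poly 'F_b}) : R :=
  \sum_(u : {set 'I_d} | (u != finset.set0) && (u \subset below d s))
    wt gamma u * \sum_(1 <= n < b ^ m) \prod_(j in u) log_factor R m p (g j) n.

Definition in_stage d n s (k : {ffun 'I_d -> 'I_n}) : bool :=
  (fsupp k != finset.set0) && (fsupp k \subset below d s).

Definition dual_sum (R : realType) (b m : nat) (gamma : weights R) (p : {poly 'F_b}) d
    (s : nat) (g : 'I_d -> {poly 'F_b}) : R :=
  \sum_(k : {ffun 'I_d -> 'I_(b ^ m)} | in_stage s k && dual m p g (fun j => k j))
    walsh_weight b gamma k.

Definition stage_sum (R : realType) (b m : nat) (gamma : weights R) d s : R :=
  \sum_(k : {ffun 'I_d -> 'I_(b ^ m)} | in_stage s k) walsh_weight b gamma k.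

Lemma wal10 (R : realType) b (x : R) : wal1 b 0 x = 1.
Proof. by rewrite /wal1 big_geq// mulr0 cos0 sin0. Qed.

Lemma lau_0 b m (p : {poly 'F_b}) : lau m p 0 = 0.
Proof. by apply/rowP => i; rewrite !mxE /= mul0r div0p coef0. Qed.

Lemma nat_poly_0 b : nat_poly b 0 = 0.
Proof. by apply/polyP => k; rewrite coef_poly coef0 div0n mod0n; case: ifP. Qed.

(** Guarantees that for n > 0 the logarithm is taken at a nonzero coordinate, as [log_factor_walsh]
    requires. *)
Lemma lau_nat_poly_neq0 b m (p g : {poly 'F_b}) n :
  prime b -> irreducible_poly p -> size p = m.+1 -> g \in Gstar b m ->
  (0 < n < b ^ m)%N -> lau m p (nat_poly b n * g) != 0.
Proof.
move=> pb pirr sp gG /andP[n0 nN]; apply: contraL n0 => /eqP lau0.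
rewrite -eqn0Ngt; apply/eqP/(dig_inj pb nN); first by rewrite expn_gt0 prime_gt0.
apply: (lau_mul_inj pirr sp (Gstar_ndvdp sp gG)); rewrite /= -nat_poly_dig// lau0.
by rewrite dig0 raddf0 mul0r lau_0.
Qed.

(** Expanding each product by [log_factor_walsh] and collecting by support leaves, for each k, the
    sum of wal_k over the points with n > 0: N - 1 for dual k and -1 otherwise. The subtracted term
    is free of g, so minimising K minimises the dual sum. *)
Lemma Kpart_dual_sum (R : realType) (b m : nat) (gamma : weights R) (p : {poly 'F_b}) d s
    (g : 'I_d -> {poly 'F_b}) :
  prime b -> irreducible_poly p -> size p = m.+1 ->
  (forall j : 'I_d, (j < s)%N -> g j \in Gstar b m) ->
  Kpart m gamma p s g =
  (b ^ m)%:R * dual_sum m gamma p s g - stage_sum b m gamma d s.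
Proof.
move=> pb pirr sp gG; set N := (b ^ m)%N.
have N0 : (0 < N)%N by rewrite expn_gt0 prime_gt0.
have toC := complexI (R := R).
pose x n j := vmap R m (laurent (nat_poly b n * g j) p).
pose W (k : {ffun 'I_d -> 'I_N}) n := \prod_j wal1 b (k j) (x n j).
have factor n (u : {set 'I_d}) : (0 < n < N)%N -> u \subset below d s ->
    (\prod_(j in u) log_factor R m p (g j) n)%:C%C =
    \sum_(k : {ffun 'I_d -> 'I_N} | fsupp k == u)
      (\prod_j b%:R ^- trunc_log b (k j))%:C%C * W k n.
  move=> nN us; rewrite rmorph_prod/=.
  under eq_bigr => j ju.
    rewrite log_factor_walsh//; first over.
    apply: lau_nat_poly_neq0 => //; apply: gG.
    by move/fintype.subsetP : us => /(_ _ ju); rewrite inE.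
  rewrite (@prod_sum_fsupp _ d N u (fun j k => (b%:R ^- trunc_log b k)%:C%C * wal1 b k (x n j)))//.
  apply: eq_bigr => k /eqP ku; rewrite big_split/=; congr (_ * _).
    rewrite rmorph_prod/= [RHS](bigID (mem u))/= [X in _ * X]big1 ?mulr1// => j.
    by rewrite -ku inE negbK => /eqP ->; rewrite trunc_log0 expr0 invr1.
  rewrite /W [RHS](bigID (mem u))/= [X in _ * X]big1 ?mulr1// => j.
  by rewrite -ku inE negbK => /eqP ->; rewrite wal10.
(* The point with n = 0 has Walsh value 1; the complete character sum contains it and K omits it. *)
have WE k : \sum_(1 <= n < N) W k n =
    (b ^ m)%:R * (dual m p g (fun j => k j))%:R - 1.
  have := sum_prod_wal1_dual R m p g (fun j => k j) pb.
  rewrite big_ltn//= [X in X + _]big1 => [|j _]; last first.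
    rewrite wal1_vmap// nat_poly_0 mul0r lau_0 /dotp big1 ?chi0// => i _.
    by rewrite [X in _ * X]mxE mulr0.
  move=> WE; apply/eqP; rewrite eq_sym subr_eq eq_sym addrC; apply/eqP; rewrite WE.
  by case: ifP; rewrite ?mulr1 ?mulr0.
apply: toC; rewrite /Kpart rmorph_sum/=.
transitivity (\sum_(k : {ffun 'I_d -> 'I_N} | in_stage s k)
   (walsh_weight b gamma k)%:C%C * \sum_(1 <= n < N) W k n).
  rewrite [RHS](partition_big (@fsupp d N)
    (fun u => (u != finset.set0) && (u \subset below d s)))//=.
  apply: eq_bigr => u /andP[u0 us]; rewrite rmorphM rmorph_sum/=.
  transitivity ((wt gamma u)%:C%C * \sum_(1 <= n < N)
      \sum_(k : {ffun 'I_d -> 'I_N} | fsupp k == u)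
      (\prod_j b%:R ^- trunc_log b (k j))%:C%C * W k n).
    by congr (_ * _); apply: eq_big_nat => n nN; rewrite factor.
  rewrite exchange_big/= mulr_sumr; apply: eq_big => [k|k /eqP ku].
    by rewrite /in_stage; case: eqP => [->|]; rewrite ?andbF// u0 us.
  by rewrite -mulr_sumr mulrA /walsh_weight ku rmorphM.
rewrite (eq_bigr (fun k => (walsh_weight b gamma k * (N%:R * (dual m p g (fun j => k j))%:R - 1))%:C%C)).
  rewrite -rmorph_sum/=; congr (_%:C%C).
  under eq_bigr do rewrite mulrBr mulr1.
  rewrite sumrB; congr (_ - _); rewrite /dual_sum mulr_sumr [RHS]big_mkcondr/=.
  by apply: eq_bigr => k _; case: (dual _ _ _ _); rewrite ?mulr1 ?mulr0// mulrC.
by move=> k _; rewrite WE [RHS]rmorphM; congr (_ * _); rewrite rmorphB rmorphM/= !rmorph_nat.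
Qed.

(** Subsets of the positions in [gs] correspond, through the inclusion [w], to subsets of the first
    [size gs] elements of ['I_d], and both name the same set of naturals in [eta]. *)
Lemma Kfun_Kpart (R : realType) (b m : nat) (eta : weights R) (p : {poly 'F_b})
    (gs : seq {poly 'F_b}) d : (size gs <= d)%N ->
  Kfun m eta p gs = Kpart m eta p (size gs) (fun j : 'I_d => gs`_j).
Proof.
move=> sd; pose w := widen_ord sd.
have w_inj : injective w by move=> i j /(congr1 val) /= ij; exact: val_inj.
pose wi (u : {set 'I_(size gs)}) : {set 'I_d} := (w @: u)%SET.
pose wp (u : {set 'I_d}) : {set 'I_(size gs)} := (w @^-1: u)%SET.
have wiK u : wp (wi u) = u.
  by apply/setP => i; rewrite inE mem_imset.
rewrite /Kpart (reindex_onto wi wp); last first.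
  move=> u /andP[_ /fintype.subsetP us]; apply/setP => j; apply/imsetP/idP.
    by move=> [i iu ->]; move: iu; rewrite inE.
  move=> ju; have := us j ju; rewrite inE => js.
  have jE : j = w (Ordinal js) by exact: val_inj.
  by exists (Ordinal js) => //; rewrite inE -jE.
have uw u : wi u \subset below d (size gs).
  by apply/fintype.subsetP => j /imsetP[i _ ->]; rewrite inE /=.
have w0 u : (wi u == finset.set0) = (u == finset.set0).
  apply/eqP/eqP => [u0|->]; last by rewrite /wi imset0.
  by rewrite -(wiK u) u0 /wp preimset0.
rewrite /Kfun; apply: eq_big => [u|u _].
  by rewrite uw andbT w0 wiK eqxx andbT.
congr (_ * _).
  rewrite /wt; congr eta; apply/fsetP => x; apply/imfsetP/imfsetP => /=.
    by move=> [i iu ->]; exists (w i) => //; exact: imset_f.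
  by move=> [j /imsetP[i iu ->] ->]; exists i.
apply: eq_big_nat => n _; rewrite /log_prod big_imset//=.
by move=> i j _ _; exact: w_inj.
Qed.

(** * Averaging over one component and the full construction *)

Definition upd (A : Type) d (g : 'I_d -> A) s (h : A) (j : 'I_d) : A :=
  if (j : nat) == s then h else g j.

Lemma dual_eq_supp b m p d n (g g' : 'I_d -> {poly 'F_b}) (k : {ffun 'I_d -> 'I_n}) :
  (forall j, j \in fsupp k -> g j = g' j) ->
  dual m p g (fun j => k j) = dual m p g' (fun j => k j).
Proof.
move=> gg'; apply: eq_forallb => v; congr (_ == _); apply: eq_bigr => j _.
have [/gg' -> //|] := boolP (j \in fsupp k).
by rewrite inE negbK => /eqP ->; rewrite dig0 !dotp0l.
Qed.

Lemma walsh_weight_ge0 (R : realType) (b : nat) (gamma : weights R) d n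
  (k : {ffun 'I_d -> 'I_n}) : (forall u, 0 < gamma u) -> 0 <= walsh_weight b gamma k.
Proof.
move=> g0; rewrite mulr_ge0 ?(ltW (g0 _))//; apply: prodr_ge0 => j _.
by rewrite invr_ge0 exprn_ge0.
Qed.

(** In the difference of the two duality conditions the coordinates other than s cancel, so the
    digit vector of k_s annihilates all multiples of v - v'. If v and v' differed, nondegeneracy
    would force k_s = 0. *)
Lemma dual_coord_uniq b m p d (g : 'I_d -> {poly 'F_b}) (k : 'I_d -> nat) (s : 'I_d)
    (v v' : 'rV['F_b]_m) :
  prime b -> irreducible_poly p -> size p = m.+1 -> (0 < k s < b ^ m)%N ->
  dual m p (upd g s (rVpoly v)) k -> dual m p (upd g s (rVpoly v')) k -> v = v'.
Proof.
move=> pb pirr sp /andP[ks0 ksN] /forallP dv /forallP dv'; apply/eqP.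
rewrite -subr_eq0; apply: contraTT ks0 => vv0; rewrite -eqn0Ngt; apply/eqP.
apply: (dig_inj pb ksN); rewrite ?expn_gt0 ?prime_gt0// dig0.
apply: (@dotp_lau_nondegenerate b m p pirr sp (rVpoly (v - v'))).
  apply: (Gstar_ndvdp sp); rewrite inE size_poly andbT.
  by apply: contra vv0 => /eqP e; rewrite -[v - v']rVpolyK e raddf0.
move=> w.
pose rest := \sum_(j | j != s) dotp (dig b m (k j)) (lau m p (rVpoly w * g j)).
have E u : \sum_j dotp (dig b m (k j)) (lau m p (rVpoly w * upd g s (rVpoly u) j)) =
    dotp (dig b m (k s)) (lau m p (rVpoly w * rVpoly u)) + rest.
  rewrite (bigD1 s)//= {1}/upd eqxx; congr (_ + _).
  by apply: eq_bigr => j js; rewrite /upd (negbTE (js : (j : nat) != s)).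
have := dv w; have := dv' w; rewrite !E => /eqP e' /eqP e.
move: e; rewrite -e' => /addIr e.
rewrite raddfB mulrBr lauB.
rewrite dotpBr e subrr//.
Qed.

Lemma in_stageS d n s (k : {ffun 'I_d -> 'I_n}) (S : 'I_d) : S = s :> nat ->
  in_stage s k = in_stage s.+1 k && ((k S : nat) == 0%N).
Proof.
move=> Ss; rewrite /in_stage -andbA; congr (_ && _).
apply/fintype.subsetP/andP => [h|[/fintype.subsetP h /eqP kS] j jk].
  split; first by apply/fintype.subsetP => j /h; rewrite !inE; exact: ltnW.
  by apply: contraT => kS; have := h S; rewrite !inE Ss ltnn => /(_ kS).
have := h j jk; rewrite !inE ltnS leq_eqVlt => /orP[/eqP js|//].
by move: jk; rewrite inE (_ : j = S) ?kS//; apply: val_inj; rewrite /= Ss.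
Qed.

(* Averaging over the last component: a vector with a nonzero last coordinate is
   dual for at most one choice of that component. *)
Lemma dual_sum_step (R : realType) (b m : nat) (gamma : weights R) (p : {poly 'F_b}) d
    (S : 'I_d) (g : 'I_d -> {poly 'F_b}) :
  prime b -> irreducible_poly p -> size p = m.+1 -> (forall u, 0 < gamma u) ->
  (forall h, h \in Gstar b m ->
    dual_sum m gamma p S.+1 g <= dual_sum m gamma p S.+1 (upd g S h)) ->
  ((b ^ m)%:R - 1) * (dual_sum m gamma p S.+1 g - dual_sum m gamma p S g) <=
  stage_sum b m gamma d S.+1 - stage_sum b m gamma d S.
Proof.
move=> pb pirr sp g0 gmin; set N := (b ^ m)%N.
have split (P : pred {ffun 'I_d -> 'I_N}) (F : {ffun 'I_d -> 'I_N} -> R) :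
   \sum_(k | in_stage S.+1 k && P k) F k = \sum_(k | in_stage S k && P k) F k +
     \sum_(k | in_stage S.+1 k && ((k S : nat) != 0%N)) (P k)%:R * F k.
  rewrite (bigID (fun k : {ffun 'I_d -> 'I_N} => (k S : nat) == 0%N))/=; congr (_ + _).
    by apply: eq_bigl => k; rewrite (in_stageS _ (erefl (S : nat))) andbAC.
  rewrite [RHS]big_mkcond/= [LHS]big_mkcond/=.
  by apply: eq_bigr => k _; case: (in_stage _ _) (P k) (_ == _) => [] [] []//=;
     rewrite ?mul1r ?mul0r.
pose D (v : 'rV['F_b]_m) (k : {ffun 'I_d -> 'I_N}) := dual m p (upd g S (rVpoly v)) (fun j => k j).
(* Minimality is tested against the candidate [rVpoly v]. Dual vectors with entry 0 at S are the
   same for both choices and cancel. *)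
have step v : v != 0 -> dual_sum m gamma p S.+1 g - dual_sum m gamma p S g <=
    \sum_(k : {ffun 'I_d -> 'I_N} | in_stage S.+1 k && ((k S : nat) != 0%N))
      (D v k)%:R * walsh_weight b gamma k.
  move=> v0; rewrite lerBlDl; apply: le_trans (gmin (rVpoly v) _) _.
    rewrite inE size_poly andbT.
    by apply: contra v0 => /eqP e; rewrite -[v]rVpolyK e raddf0.
  rewrite [X in X <= _]split lerD2r /dual_sum le_eqVlt; apply/orP; left; apply/eqP.
  apply: eq_bigl => k; case: (boolP (in_stage S k)) => [/andP[_ /fintype.subsetP ks]|//].
  rewrite !andTb;   apply: dual_eq_supp => j jk; rewrite /upd; case: eqP => // e.
  by have := ks j jk; rewrite inE e ltnn.
have cardN : #|[pred v : 'rV['F_b]_m | v != 0]| = N.-1.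
  have := cardC1 (0 : 'rV['F_b]_m); rewrite card_mx mul1n card_Fp// => <-.
have N0 : (0 < N)%N by rewrite expn_gt0 prime_gt0.
have N1 : N.-1%:R = N%:R - 1 :> R by rewrite -subn1 natrB.
(* The inequality [step] is summed over the N - 1 nonzero v; after exchanging sums, each k is
   counted at most once. *)
rewrite -N1 -cardN mulr_natl -sumr_const.
apply: le_trans (_ : \sum_(v | v != 0)
    \sum_(k : {ffun 'I_d -> 'I_N} | in_stage S.+1 k && ((k S : nat) != 0%N))
      (D v k)%:R * walsh_weight b gamma k <= _).
  by apply: ler_sum => v v0; exact: step.
have -> : stage_sum b m gamma d S.+1 - stage_sum b m gamma d S =
    \sum_(k : {ffun 'I_d -> 'I_N} | in_stage S.+1 k && ((k S : nat) != 0%N))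
      walsh_weight b gamma k.
  rewrite /stage_sum; under eq_bigl do rewrite -[in_stage _ _]andbT.
  rewrite split [X in _ - X](eq_bigl (fun k => in_stage S k && true)); last first.
    by move=> k; rewrite andbT.
  by rewrite addrAC subrr add0r; apply: eq_bigr => k _; rewrite mul1r.
rewrite exchange_big/=; apply: ler_sum => k /andP[_ kS].
rewrite -mulr_suml ler_piMl ?walsh_weight_ge0//.
rewrite -natr_sum -[1]/(1%:R) ler_nat.
rewrite (eq_bigr (fun v => if D v k then 1 else 0)%N) => [|v _]; last by case: (D v k).
rewrite -big_mkcondr/= sum1_card.
apply/card_le1_eqP => v v'; rewrite !unfold_in => /andP[_ dv] /andP[_ dv'].
by apply: (@dual_coord_uniq b m p d g (fun j => k j) S v' v) => //; rewrite lt0n kS ltn_ord.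
Qed.

Lemma one_Gstar b m : (0 < m)%N -> (1 : {poly 'F_b}) \in Gstar b m.
Proof. by move=> m0; rewrite inE oner_eq0 size_poly1. Qed.

(** Each stage minimises over the finitely many nonzero coefficient vectors of length m. Appending a
    component preserves the earlier conditions, which involve only prefixes. *)
Lemma cbc_output_exists (R : realType) (b m : nat) (eta : weights R) (p : {poly 'F_b}) d :
  (0 < m)%N -> (0 < d)%N -> exists g : d.-tuple {poly 'F_b}, cbc_output m eta p g.
Proof.
move=> m0; case: d => // d _.
suff [gs [sgs [gs0 gsmin]]] : exists gs : seq {poly 'F_b}, size gs = d.+1 /\ gs`_0 = 1 /\
    forall s, (0 < s < d.+1)%N -> gs`_s \in Gstar b m /\
    forall h, h \in Gstar b m ->
      Kfun m eta p (rcons (take s gs) gs`_s) <= Kfun m eta p (rcons (take s gs) h).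
  by move/eqP: sgs => sgs; exists (Tuple sgs).
elim: d => [|d [gs [sgs [gs0 gsmin]]]].
  by exists [:: 1]; split=> //; split=> // s; rewrite ltnS => /andP[/leq_trans /[apply]].
have v0P : (poly_rV 1 : 'rV['F_b]_m) != 0.
  apply: contraTneq (one_Gstar b m0) => e.
  by rewrite -(@poly_rV_K _ m 1) ?size_poly1// e raddf0 inE eqxx.
case: (@arg_minP _ _ _ (poly_rV 1 : 'rV['F_b]_m) (fun v => v != 0)
   (fun v => Kfun m eta p (rcons gs (rVpoly v))) v0P) => v vn0 vmin.
have tk s x : (s <= d.+1)%N -> take s (rcons gs x) = take s gs.
  by move=> sd; rewrite -cats1 takel_cat ?sgs.
exists (rcons gs (rVpoly v)); rewrite size_rcons sgs; split=> //.
rewrite nth_rcons sgs /= gs0; split=> // s /andP[s0]; rewrite ltnS leq_eqVlt.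
move=> /orP[/eqP sd|sd]; last first.
  rewrite nth_rcons sgs sd tk 1?ltnW//.
  by apply: gsmin; rewrite s0.
rewrite nth_rcons sgs sd ltnn eqxx tk// take_oversize ?sgs//; split=> [|h /andP[h0 sh]].
  by rewrite inE size_poly andbT; apply: contra vn0 => /eqP e; rewrite -[v]rVpolyK e raddf0.
rewrite -(poly_rV_K sh); apply: vmin.
by apply: contra h0 => /eqP e; rewrite -(poly_rV_K sh) e raddf0.
Qed.

Lemma cbc_output_Gstar (R : realType) (b m : nat) (eta : weights R) (p : {poly 'F_b}) d
    (g : d.-tuple {poly 'F_b}) : (0 < m)%N -> cbc_output m eta p g ->
  forall j, tnth g j \in Gstar b m.
Proof.
move=> m0 [g0 gmin] j; rewrite (tnth_nth 0); case: (posnP j) => [->|j0].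
  by rewrite g0 one_Gstar.
by have [] := gmin j; rewrite ?j0/=.
Qed.

Lemma stage_sum_ge0 (R : realType) (b m : nat) (gamma : weights R) d s :
  (forall u, 0 < gamma u) -> 0 <= stage_sum b m gamma d s.
Proof. by move=> g0; apply: sumr_ge0 => k _; exact: walsh_weight_ge0. Qed.

(** By induction on the stage, the increments bounded in [dual_sum_step] telescope. *)
Lemma dual_sum_cbc (R : realType) (b m : nat) (gamma : weights R) (p : {poly 'F_b}) d
    (g : d.-tuple {poly 'F_b}) :
  prime b -> irreducible_poly p -> size p = m.+1 -> (forall u, 0 < gamma u) ->
  cbc_output m gamma p g ->
  ((b ^ m)%:R - 1) * dual_sum m gamma p d (tnth g) <= stage_sum b m gamma d d.
Proof.
move=> pb pirr sp g0 cbc; have [g1 gmin] := cbc.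
have m0 : (0 < m)%N by case: pirr; rewrite sp ltnS.
have gG := cbc_output_Gstar m0 cbc.
have N0 : 0 < (b ^ m)%:R :> R by rewrite ltr0n expn_gt0 prime_gt0.
suff H s : (s <= d)%N ->
    ((b ^ m)%:R - 1) * dual_sum m gamma p s (tnth g) <= stage_sum b m gamma d s.
  exact: H.
have stage0 n (k : {ffun 'I_d -> 'I_n}) : in_stage 0 k = false.
  apply/negbTE; rewrite negb_and negbK -implyNb; apply/implyP => k0.
  by apply: contra k0 => /fintype.subsetP h; apply/eqP/setP => j; apply/idP/idP => [/h|]; rewrite !inE.
elim: s => [|s IH] sd.
  by rewrite /dual_sum /stage_sum !big1 ?mulr0// => k; rewrite stage0.
pose S := Ordinal sd.
(* The first component is prescribed, not minimised. Here the dual sum is empty: nondegeneracy in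
   one coordinate forces the only possibly nonzero entry, which is below b^m, to be 0. *)
have [s0|s0] := posnP s.
  rewrite /dual_sum big1 ?mulr0 ?stage_sum_ge0// => k /andP[].
  rewrite s0 => kst /forallP kd.
  have kS : (k S : nat) != 0%N.
    move: kst => /andP[/set0Pn[j jk] /fintype.subsetP h].
    have := h j jk; rewrite inE ltnS leqn0 => /eqP j0.
    by move: jk; rewrite inE (_ : j = S)//; apply: val_inj; rewrite /= j0 s0.
  suff : (k S : nat) = 0%N by move/eqP; rewrite (negbTE kS).
  apply: (dig_inj pb (ltn_ord _)); rewrite ?expn_gt0 ?prime_gt0// dig0.
  apply: (dotp_lau_nondegenerate pirr sp (Gstar_ndvdp sp (gG S))) => v.
  have := kd v; rewrite (bigD1 S)//= big1 ?addr0 => [/eqP //|j jS].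
  suff -> : (k j : nat) = 0%N by rewrite dig0 dotp0l.
  apply/eqP; apply: contraTT kst => kj; rewrite negb_and; apply/orP; right.
  apply/subsetPn; exists j; rewrite ?inE// ltnS leqn0.
  by rewrite -s0; apply: contra jS => /eqP js; apply/eqP/val_inj.
(* Minimality of K passes to the dual sum, as K is N times it minus a term independent of h. *)
have Kle h : h \in Gstar b m ->
    dual_sum m gamma p s.+1 (tnth g) <= dual_sum m gamma p s.+1 (upd (tnth g) s h).
  move=> hG; have s0d : (0 < s < d)%N by rewrite s0.
  have [_ /(_ h hG)] := gmin s s0d.
  have sz h' : size (rcons (take s g) h') = s.+1.
    by rewrite size_rcons size_takel// size_tuple ltnW.
  have nthE h' (j : 'I_d) : (j < s.+1)%N -> (rcons (take s g) h')`_j = upd (tnth g) s h' j.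
    rewrite ltnS leq_eqVlt nth_rcons size_takel /upd; last by rewrite size_tuple ltnW.
    move=> /orP[/eqP ->|js]; first by rewrite ltnn eqxx.
    by rewrite js (ltn_eqF js) nth_take// (tnth_nth 0).
  have dsE h' : dual_sum m gamma p s.+1 (fun j : 'I_d => (rcons (take s g) h')`_j) =
      dual_sum m gamma p s.+1 (upd (tnth g) s h').
    apply: eq_bigl => k; case: (boolP (in_stage s.+1 k)) => [/andP[_ /fintype.subsetP h2]|//].
    rewrite !andTb; apply: dual_eq_supp => j /h2; rewrite inE; exact: nthE.
  have KE h' : h' \in Gstar b m -> Kfun m gamma p (rcons (take s g) h') =
      (b ^ m)%:R * dual_sum m gamma p s.+1 (upd (tnth g) s h') - stage_sum b m gamma d s.+1.
    move=> h'G.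
    have gGs (j : 'I_d) : (j < s.+1)%N -> (rcons (take s g) h')`_j \in Gstar b m.
      by move=> /nthE ->; rewrite /upd; case: ifP.
    have szd : (size (rcons (take s g) h') <= d)%N by rewrite sz.
    rewrite (Kfun_Kpart m gamma p szd) sz -dsE.
    exact: (Kpart_dual_sum gamma pb pirr sp gGs).
  have gsG : g`_s \in Gstar b m by have := gG S; rewrite (tnth_nth 0).
  have dsg : dual_sum m gamma p s.+1 (upd (tnth g) s g`_s) = dual_sum m gamma p s.+1 (tnth g).
    apply: eq_bigl => k; congr (_ && _); apply: dual_eq_supp => j _; rewrite /upd.
    by case: eqP => // js; rewrite (tnth_nth 0) js.
  by rewrite (KE _ hG) (KE _ gsG) dsg lerD2r ler_pM2l.
have := @dual_sum_step R b m gamma p d S (tnth g) pb pirr sp g0 Kle.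
rewrite mulrBr.
have := IH (ltnW sd); lra.
Qed.

(** * Growth of the sum over all vectors in the box *)

(** Each of the m blocks [b^n, b^(n+1)) holds (b - 1) b^n terms equal to b^(-n). *)
Lemma sum_log_weights (R : realType) b m : (1 < b)%N ->
  \sum_(1 <= k < b ^ m) b%:R ^- trunc_log b k = m%:R * (b%:R - 1) :> R.
Proof.
move=> b1; have b0 : b%:R != 0 :> R by rewrite pnatr_eq0 -lt0n ltnW.
elim: m => [|m IH]; first by rewrite expn0 big_geq// mul0r.
have le1 : (b ^ m <= b ^ m.+1)%N by rewrite leq_exp2l.
rewrite (big_cat_nat (n := b ^ m))//= ?expn_gt0 ?(ltnW b1)// IH.
rewrite (eq_big_nat _ _ (F2 := fun=> b%:R ^- m)) => [|k /(trunc_log_eq b1) -> //].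
rewrite sumr_const_nat -[X in _ + X]mulr_natl natrB// !natrX -[m.+1%:R]natr1 [RHS]mulrDl mul1r; congr (_ + _).
by rewrite exprS mulrBl mulfK ?expf_neq0// mulfV ?expf_neq0.
Qed.

Lemma fset_of_ords0 d : fset_of_ords (finset.set0 : {set 'I_d}) = fset0.
Proof. by apply/fsetP => x; rewrite inE; apply/imfsetP => -[j]; rewrite inE. Qed.

Lemma wt_setU1_le (R : realType) (gamma : weights R) d (S : 'I_d) (u : {set 'I_d}) :
  (forall u, 0 < gamma u) -> u \subset below d S ->
  wt gamma (S |: u)%SET <=
  (\big[Num.max/0]_(v : {set 'I_S}) wratio gamma v) * wt gamma u.
Proof.
move=> g0 /fintype.subsetP us; pose w := widen_ord (ltnW (ltn_ord S)).
pose v : {set 'I_S} := (w @^-1: u)%SET.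
have vu : fset_of_ords v = fset_of_ords u.
  apply/fsetP => x; apply/imfsetP/imfsetP => /= -[j ju ->].
    by exists (w j) => //; move: ju; rewrite inE.
  have js := us j ju; rewrite inE in js.
  by exists (Ordinal js) => //; rewrite inE (_ : w _ = j)//; exact: val_inj.
have Su : fset_of_ords (S |: u)%SET = ((S : nat) |` fset_of_ords v)%fset.
  rewrite vu; apply/fsetP => x; apply/imfsetP/idP => /=.
    move=> [j]; rewrite !inE => /orP[/eqP -> ->|ju ->]; rewrite ?eqxx//.
    by apply/orP; right; apply/imfsetP; exists j.
  rewrite !inE => /orP[/eqP ->|/imfsetP[j ju ->]].
    by exists S => //; rewrite !inE eqxx.
  by exists j => //; rewrite !inE [j \in u]ju orbT.
rewrite /wt Su -vu -ler_pdivrMr ?g0//.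
exact: (le_bigmax _ (fun v => wratio gamma v) v).
Qed.

Lemma stage_sum_le_prod (R : realType) b m (gamma : weights R) d :
  (1 < b)%N -> (forall u, 0 < gamma u) ->
  stage_sum b m gamma d d <= gamma fset0 *
    \prod_(0 <= j < d)
      (1 + (\big[Num.max/0]_(v : {set 'I_j}) wratio gamma v) * (m%:R * (b%:R - 1))).
Proof.
move=> b1 g0; set M : R := m%:R * (b%:R - 1); pose Gam j := \big[Num.max/0]_(v : {set 'I_j}) wratio gamma v.
have N0 : (0 < b ^ m)%N by rewrite expn_gt0 (ltnW b1).
have M0 : 0 <= M by rewrite mulr_ge0// subr_ge0 ler1n ltnW.
(* The empty set is included in [A], so that the recursion starts from [gamma fset0] and [A] becomes
   multiplicative in the coordinates. *)
pose A s := \sum_(u : {set 'I_d} | u \subset below d s) wt gamma u * M ^+ #|u|.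
have -> : stage_sum b m gamma d d =
    \sum_(u : {set 'I_d} | (u != finset.set0) && (u \subset below d d)) wt gamma u * M ^+ #|u|.
  rewrite /stage_sum (partition_big (@fsupp d (b ^ m))
    (fun u => (u != finset.set0) && (u \subset below d d)))//=.
  apply: eq_bigr => u u0; rewrite -prodr_const /M -(@sum_log_weights R b m b1).
  rewrite (@prod_sum_fsupp _ d (b ^ m) u (fun j k => b%:R ^- trunc_log b k))// mulr_sumr.
  apply: eq_big => [k|k /andP[_ /eqP ku]].
    by rewrite /in_stage; case: (fsupp k =P u) => [->|]; rewrite ?andbF// u0.
  rewrite /walsh_weight ku; congr (_ * _).
  rewrite (bigID (mem u))/= [X in _ * X]big1 ?mulr1// => j.
  by rewrite -ku inE negbK => /eqP ->; rewrite trunc_log0 expr0 invr1.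
apply: (@le_trans _ _ (A d)).
  rewrite /A [leRHS](bigID (fun u : {set 'I_d} => u != finset.set0))/=.
  under eq_bigl do rewrite andbC.
  rewrite lerDl sumr_ge0// => u _.
  by rewrite mulr_ge0 ?exprn_ge0// ltW// g0.
suff H s : (s <= d)%N -> A s <= gamma fset0 * \prod_(0 <= j < s) (1 + Gam j * M).
  exact: H.
elim: s => [|s IH] sd.
  rewrite big_geq// mulr1 /A (eq_bigl (pred1 (finset.set0 : {set 'I_d}))).
    by rewrite big_pred1_eq cards0 mulr1 /wt fset_of_ords0.
  by move=> u; rewrite /= -finset.subset0.
pose S := Ordinal sd.
(* Subsets of the first s + 1 coordinates are split by whether they contain the last one; those that
   do lose a factor [Gam s * M] when it is removed. *)
have -> : A s.+1 = A s + \sum_(u : {set 'I_d} | u \subset below d s)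
    wt gamma (S |: u)%SET * M ^+ #|u|.+1.
  rewrite /A (bigID (fun u : {set 'I_d} => S \in u))/= addrC; congr (_ + _).
    apply: eq_bigl => u; apply/andP/fintype.subsetP => [[/fintype.subsetP us Su] j ju|us].
      have := us j ju; rewrite !inE ltnS leq_eqVlt => /orP[/eqP js|//].
      by move: Su; rewrite (_ : S = j) ?ju//; exact: val_inj.
    split; first by apply/fintype.subsetP => j /us; rewrite !inE; exact: ltnW.
    by apply/negP => /us; rewrite inE ltnn.
  rewrite (reindex_onto (fun u => S |: u)%SET (fun u => u :\ S)%SET)/=; last first.
    by move=> u /andP[_ Su]; rewrite finset.setD1K.
  have SE (u : {set 'I_d}) : u \subset below d s -> S \notin u.
    by move=> /fintype.subsetP us; apply/negP => /us; rewrite inE ltnn.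
  apply: eq_big => [u|u].
    apply/andP/idP => [[/andP[/fintype.subsetP us _] /eqP ue]|us].
      apply/fintype.subsetP => j ju; have : j \in (S |: u)%SET by rewrite inE ju orbT.
      move=> /us; rewrite !inE ltnS leq_eqVlt => /orP[/eqP js|//].
      move: ju; rewrite -ue (_ : j = S) ?inE ?eqxx//; exact: val_inj.
    split; last by rewrite finset.setU1K// SE.
    rewrite finset.setU11 andbT; apply/fintype.subsetP => j; rewrite !inE.
    move=> /orP[/eqP -> //|/(fintype.subsetP us)]; rewrite inE; exact: ltnW.
  move=> /andP[_ /eqP ue]; rewrite finset.cardsU1 (_ : S \notin u)//.
  by rewrite -ue !inE eqxx.
rewrite big_nat_recr//= mulrA mulrDr mulr1 -/(Gam s).
have IHs := IH (ltnW sd).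
have : \sum_(u : {set 'I_d} | u \subset below d s) wt gamma (S |: u)%SET * M ^+ #|u|.+1
    <= A s * (Gam s * M).
  rewrite /A mulr_suml; apply: ler_sum => u us.
  rewrite exprSr (_ : _ * _ * (_ * _) = Gam s * wt gamma u * (M ^+ #|u| * M)); last by ring.
  apply: ler_wpM2r; first by rewrite mulr_ge0 ?exprn_ge0.
  exact: (@wt_setU1_le R gamma d S u g0 us).
have Gs0 : 0 <= Gam s by exact: bigmax_ge_id.
move=> h; apply: le_trans (lerD IHs h) _.
by rewrite lerD2l; apply: ler_wpM2r IHs; exact: mulr_ge0.
Qed.

(** A polynomial in x is dominated by any growing exponential. Half of e goes to the induction; with
    c = a_J / (e/2), the last factor is at most (1 + c)(1 + (e/2) x). *)
Lemma prod_le_expR_fin (R : realType) (a : nat -> R) J (e : R) : (forall j, 0 <= a j) ->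
  0 < e -> exists2 C : R, 0 < C & forall x, 0 <= x ->
  \prod_(0 <= j < J) (1 + a j * x) <= C * expR (e * x).
Proof.
move=> a0; elim: J e => [|J IH] e e0.
  by exists 1 => // x x0; rewrite big_geq// mul1r -expR0 ler_expR mulr_ge0// ltW.
have e20 : 0 < e / 2 by rewrite divr_gt0.
have [C C0 hC] := IH _ e20.
exists (C * (1 + a J / (e / 2))).
  by rewrite mulr_gt0// ltr_pwDl// divr_ge0// ltW.
move=> x x0; rewrite big_nat_recr//= {2}[e]splitr mulrDl expRD mulrACA.
have ax0 : 0 <= a J * x by rewrite mulr_ge0.
apply: ler_pM; rewrite ?hC ?addr_ge0//.
  by apply: prodr_ge0 => j _; rewrite addr_ge0// mulr_ge0.
apply: le_trans (_ : (1 + a J / (e / 2)) * (1 + e / 2 * x) <= _); last first.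
  by rewrite ler_wpM2l ?expR_ge1Dx// addr_ge0// divr_ge0// ltW.
rewrite mulrDr mulr1 mulrDl mul1r -[a J * x](_ : a J / (e / 2) * (e / 2 * x) = _); last first.
  by rewrite mulrA divfK// gt_eqF.
have : 0 <= a J / (e / 2) by rewrite divr_ge0// ltW.
have : 0 <= e / 2 * x by rewrite mulr_ge0// ltW.
lra.
Qed.

(** Choose J so that the sums of a_j beyond J are at most e/2. The tail factors are then bounded by
    exp(e x / 2) through 1 + y <= exp y, and the J head factors by the finite case, so C is free of
    d. *)
Lemma prod_le_expR (R : realType) (a : nat -> R) (e : R) : (forall j, 0 <= a j) ->
  (\sum_(0 <= j <oo) (a j)%:E < +oo)%E -> 0 < e ->
  exists2 C : R, 0 < C & forall d x, 0 <= x ->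
  \prod_(0 <= j < d) (1 + a j * x) <= C * expR (e * x).
Proof.
move=> a0 suma e0; have e20 : 0 < e / 2 by rewrite divr_gt0.
have aE0 k : (0 <= (a k)%:E)%E by rewrite lee_fin.
have [J hJ] : exists J, forall d, \sum_(J <= j < J + d) a j <= e / 2.
  have := nneseries_tail_cvg suma (fun k _ => aE0 k).
  move=> /fine_cvgP[fintail /cvgrPdist_lt /(_ _ e20)] tail.
  near \oo => J; exists J => d.
  have finJ : (\sum_(J <= k <oo) (a k)%:E)%E \is a fin_num by near: J.
  have : `|0 - fine (\sum_(J <= k <oo) (a k)%:E)%E| < e / 2 by near: J.
  rewrite sub0r normrN ger0_norm; last by rewrite fine_ge0// nneseries_ge0.
  move=> /ltW; apply: le_trans; rewrite -lee_fin fineK// -sumEFin.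
  exact: nneseries_lim_ge.
have [C C0 hC] := prod_le_expR_fin J a0 e20.
exists C => // d x x0.
have f1 j : 1 <= 1 + a j * x by rewrite lerDl mulr_ge0.
(* All factors are at least 1, so lengthening the product to J + d is harmless and makes the head
   complete even when d < J. *)
apply: (@le_trans _ _ (\prod_(0 <= j < J + d) (1 + a j * x))).
  rewrite [leRHS](big_cat_nat (n := d))//= ?leq_addl// ler_peMr//.
    by apply: prodr_ge0 => j _; rewrite (le_trans _ (f1 j)).
  elim/big_ind : _ => // u v u1 v1; rewrite (le_trans u1)// ler_peMr// (le_trans _ u1)//.
rewrite (big_cat_nat (n := J))//= ?leq_addr// [e]splitr mulrDl expRD mulrA.
apply: ler_pM; rewrite ?hC//.
- by apply: prodr_ge0 => j _; rewrite (le_trans _ (f1 j)).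
- by apply: prodr_ge0 => j _; rewrite (le_trans _ (f1 j)).
apply: (@le_trans _ _ (expR ((\sum_(J <= j < J + d) a j) * x))); last first.
  by rewrite ler_expR ler_wpM2r.
rewrite mulr_suml expR_sum; apply: ler_prod => j _.
by rewrite (le_trans _ (f1 j))//= expR_ge1Dx.
Unshelve. all: by end_near.
Qed.

Lemma stage_sum_le (R : realType) b (gamma : weights R) (delta : R) :
  (1 < b)%N -> (forall u, 0 < gamma u) ->
  (\sum_(0 <= j <oo)
     (\big[Num.max/0]_(v : {set 'I_j}) wratio gamma v)%:E < +oo)%E -> 0 < delta ->
  exists2 C : R, 0 < C & forall m d,
    stage_sum b m gamma d d <= C * (b ^ m)%:R `^ delta.
Proof.
move=> b1 g0 sumg delta0.
have b10 : 0 < b%:R - 1 :> R by rewrite subr_gt0 ltr1n.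
have lnb : 0 < ln b%:R :> R by rewrite ln_gt0// ltr1n.
(* This rate is chosen so that at x = m (b - 1) the exponent e x equals delta ln(b^m), turning the
   exponential into N^delta. *)
have e0 : 0 < delta * ln b%:R / (b%:R - 1) by rewrite divr_gt0// mulr_gt0.
have Gam0 j : 0 <= \big[Num.max/0]_(v : {set 'I_j}) wratio gamma v by exact: bigmax_ge_id.
have [C C0 hC] := prod_le_expR Gam0 sumg e0.
exists (gamma fset0 * C); first by rewrite mulr_gt0.
move=> m d; apply: le_trans (stage_sum_le_prod m d b1 g0) _.
rewrite -mulrA ler_wpM2l ?(ltW (g0 _))//.
apply: le_trans (hC d _ _) _; first by rewrite mulr_ge0// ltW.
rewrite ler_wpM2l ?(ltW C0)// le_eqVlt; apply/orP; left; apply/eqP.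
have bm0 : (b ^ m)%:R != 0 :> R by rewrite pnatr_eq0 -lt0n expn_gt0 ltnW.
rewrite /powR (negbTE bm0); congr expR.
rewrite natrX lnXn ?ltr0n ?(ltnW b1)// -[ln _ *+ m]mulr_natl.
by field; rewrite gt_eqF.
Qed.

(** * Sums of alpha-th powers over dual vectors *)

Lemma ler_sum_injective (R : numDomainType) (I : finType) (P Q : pred I) (h : I -> I)
    (F : I -> R) : {in P &, injective h} -> (forall i, P i -> Q (h i)) ->
  (forall i, 0 <= F i) -> \sum_(i | P i) F (h i) <= \sum_(i | Q i) F i.
Proof.
move=> hinj hPQ F0; pose A : {set I} := [set i | P i]%SET.
have -> : \sum_(i | P i) F (h i) = \sum_(i in (h @: A)%SET) F i.
  rewrite big_imset/=; first by apply: eq_bigl => i; rewrite inE.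
  by move=> i j; rewrite !inE => Pi Pj; exact: hinj.
rewrite [leRHS](bigID (mem (h @: A)%SET))/= ler_wpDr ?sumr_ge0//.
rewrite le_eqVlt; apply/orP; left; apply/eqP/eq_bigl => i.
apply/idP/andP => [/imsetP[j]|[]//]; rewrite inE => Pj ->.
by split; [exact: hPQ|apply/imsetP; exists j; rewrite ?inE].
Qed.

(** Write x^a = x x^(a-1) and bound the second factor by s^(a-1), where s is the whole sum. *)
Lemma sum_powR_le (R : realType) (I : finType) (P : pred I) (x : I -> R) (a : R) :
  (forall i, 0 <= x i) -> 1 < a ->
  \sum_(i | P i) x i `^ a <= (\sum_(i | P i) x i) `^ a.
Proof.
move=> x0 a1; set s := \sum_(i | P i) x i.
have s0 : 0 <= s by exact: sumr_ge0.
have a0 : 0 < a by rewrite (lt_trans _ a1).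
rewrite -(mulr_powRB1 s0 a0) {1}/s mulr_suml; apply: ler_sum => i Pi.
rewrite -(mulr_powRB1 (x0 i) a0) ler_wpM2l// ge0_ler_powR ?nnegrE ?subr_ge0 ?(ltW a1)//.
by rewrite /s (bigD1 i)//= lerDl sumr_ge0.
Qed.

(** The reciprocal of [rweight] for the weights gamma^alpha, on a finite box. *)
Definition walsh_weight_pow (R : realType) (b : nat) (gamma : weights R) (alpha : R) d n
    (k : {ffun 'I_d -> 'I_n}) : R :=
  wt gamma (fsupp k) `^ alpha * \prod_j b%:R `^ (- (alpha * (trunc_log b (k j))%:R)).

Lemma powR_prod (R : realType) (I : finType) (P : pred I) (x : I -> R) (a : R) :
  (forall i, 0 <= x i) ->
  (\prod_(i | P i) x i) `^ a = \prod_(i | P i) x i `^ a.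
Proof.
move=> x0; suff [] : 0 <= \prod_(i | P i) x i /\
  (\prod_(i | P i) x i) `^ a = \prod_(i | P i) x i `^ a by [].
elim/big_ind2 : _ => [|u v u' v' [u0 uv] [u'0 uv']|i _]; rewrite ?powR1//.
by rewrite mulr_ge0// powRM// uv uv'.
Qed.

Lemma walsh_weight_powE (R : realType) b (gamma : weights R) (alpha : R) d n
    (k : {ffun 'I_d -> 'I_n}) : (forall u, 0 < gamma u) ->
  walsh_weight_pow b gamma alpha k = walsh_weight b gamma k `^ alpha.
Proof.
move=> g0; rewrite /walsh_weight powRM ?(ltW (g0 _))//; last first.
  by apply: prodr_ge0 => j _; rewrite invr_ge0 exprn_ge0.
rewrite /walsh_weight_pow; congr (_ * _); rewrite powR_prod => [|j]; last by rewrite invr_ge0 exprn_ge0.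
apply: eq_bigr => j _; rewrite -powR_invn// -powRrM; congr (_ `^ _).
by rewrite mulNr mulrC.
Qed.

Definition log_sum (R : realType) (b : nat) (alpha : R) n : R :=
  \sum_(1 <= k < n) b%:R `^ (- (alpha * (trunc_log b k)%:R)).

Lemma sum_walsh_weight_pow_supp (R : realType) b (gamma : weights R) (alpha : R) d n
    (u : {set 'I_d}) : (0 < n)%N ->
  \sum_(k : {ffun 'I_d -> 'I_n} | fsupp k == u) walsh_weight_pow b gamma alpha k =
  wt gamma u `^ alpha * log_sum b alpha n ^+ #|u|.
Proof.
move=> n0; rewrite -prodr_const.
rewrite (@prod_sum_fsupp _ d n u (fun j k => b%:R `^ (- (alpha * (trunc_log b k)%:R))))//.
rewrite mulr_sumr; apply: eq_bigr => k /eqP ku; rewrite /walsh_weight_pow ku; congr (_ * _).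
rewrite (bigID (mem u))/= [X in _ * X]big1 ?mulr1// => j.
by rewrite -ku inE negbK => /eqP ->; rewrite trunc_log0 mulr0 oppr0 powRr0.
Qed.

Lemma trunc_log_divX b m k : (1 < b)%N -> (b ^ m <= k)%N ->
  trunc_log b k = (m + trunc_log b (k %/ b ^ m))%N.
Proof.
move=> b1 mk; apply: trunc_log_eq => //; have bm0 : (0 < b ^ m)%N by rewrite expn_gt0 ltnW.
set q := (k %/ b ^ m)%N; have q0 : (0 < q)%N by rewrite divn_gt0.
have /andP[ql qu] := trunc_log_bounds b1 q0.
apply/andP; split.
  by rewrite expnD mulnC -leq_divRL.
by rewrite -addnS expnD mulnC -ltn_divLR.
Qed.

Lemma dotpBl (F : nzRingType) m (u v w : 'rV[F]_m) :
  dotp (u - v) w = dotp u w - dotp v w.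
Proof. by rewrite /dotp -sumrB; apply: eq_bigr => i _; rewrite !mxE mulrBl. Qed.

(** The map [h] replaces k_j by its quotient by b^m, which is nonzero, so the support is kept and
    the weight splits off N^(-alpha). It is injective on dual vectors, and its image is enlarged to
    all vectors with support u. *)
Lemma dual_high_coord_sum (R : realType) b m (gamma : weights R) (alpha : R) (p : {poly 'F_b})
    d (g : 'I_d -> {poly 'F_b}) n (u : {set 'I_d}) (j : 'I_d) :
  prime b -> irreducible_poly p -> size p = m.+1 ->
  (forall i, g i \in Gstar b m) -> j \in u -> (0 < n)%N ->
  \sum_(k : {ffun 'I_d -> 'I_n} |
      [&& fsupp k == u, dual m p g (fun i => k i) & (b ^ m <= k j)%N])
    walsh_weight_pow b gamma alpha k <=
  (b ^ m)%:R `^ (- alpha) * (wt gamma u `^ alpha * log_sum b alpha n ^+ #|u|).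
Proof.
move=> pb pirr sp gG ju n0; have b1 := prime_gt1 pb.
pose q (i : 'I_n) : 'I_n := Ordinal (leq_ltn_trans (leq_div i (b ^ m)) (ltn_ord i)).
pose h (k : {ffun 'I_d -> 'I_n}) : {ffun 'I_d -> 'I_n} := [ffun i => if i == j then q (k i) else k i].
have hsupp (k : {ffun 'I_d -> 'I_n}) : (b ^ m <= k j)%N -> fsupp (h k) = fsupp k.
  move=> kj; apply/setP => i; rewrite !inE ffunE; have [->|//] := eqVneq i j; rewrite /=.
  have bm0 : (0 < b ^ m)%N by rewrite expn_gt0 prime_gt0.
  by rewrite -!lt0n divn_gt0// kj; apply/esym/(leq_trans bm0).
rewrite -(@sum_walsh_weight_pow_supp R b gamma alpha d n u n0) mulr_sumr.
pose F (k : {ffun 'I_d -> 'I_n}) :=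
  (b ^ m)%:R `^ (- alpha) * walsh_weight_pow b gamma alpha k.
rewrite (eq_bigr (fun k => F (h k))); last first.
  move=> k /and3P[_ _ kj]; rewrite /F /walsh_weight_pow hsupp// mulrCA; congr (_ * _).
  rewrite [LHS](bigD1 j)//= [in RHS](bigD1 j)//= mulrA; congr (_ * _); last first.
    by apply: eq_bigr => i ij; rewrite ffunE (negbTE ij).
  rewrite ffunE eqxx /= (trunc_log_divX b1 kj) natrD mulrDr opprD powRD; last first.
    by rewrite pnatr_eq0 -lt0n prime_gt0// implybT.
  congr (_ * _); rewrite natrX -powR_mulrn// -powRrM.
  by rewrite mulrN mulrC.
apply: ler_sum_injective => [k l|k /and3P[ku _ kj]|k]; last first.
- by rewrite /F mulr_ge0 ?powR_ge0// mulr_ge0 ?powR_ge0// prodr_ge0.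
- by rewrite hsupp.
move=> /and3P[_ /forallP dk kj] /and3P[_ /forallP dl lj] hkl.
have kl i : i != j -> k i = l i.
  by move=> ij; have /ffunP/(_ i) := hkl; rewrite !ffunE (negbTE ij).
(* Since k and l agree off j, subtracting their duality conditions isolates coordinate j, and
   nondegeneracy identifies the two residues modulo b^m. *)
have digkl : dig b m (k j) = dig b m (l j).
  apply/eqP; rewrite -subr_eq0; apply/eqP.
  apply: (dotp_lau_nondegenerate pirr sp (Gstar_ndvdp sp (gG j))) => v.
  have := dk v; have := dl v; rewrite (bigD1 j)//= [in X in _ -> X -> _](bigD1 j)//=.
  rewrite [X in _ -> _ + X == 0 -> _](eq_bigr (fun i => dotp (dig b m (l i)) (lau m p (rVpoly v * g i)))).
    by move=> /eqP e1 /eqP e2; have /addIr e := etrans e2 (esym e1); rewrite dotpBl e subrr.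
  by move=> i /kl ->.
apply/ffunP => i; have [->|/kl //] := eqVneq i j; apply: val_inj => /=.
rewrite (divn_eq (k j) (b ^ m)) (divn_eq (l j) (b ^ m)); congr (_ * _ + _)%N.
  by have /ffunP/(_ j) := hkl; rewrite !ffunE eqxx => /(congr1 val).
have bm0 : (0 < b ^ m)%N by rewrite expn_gt0 prime_gt0.
by apply: (@dig_inj b m _ _ pb); rewrite ?ltn_mod// !dig_mod.
Qed.

Lemma log_sum_ge0 (R : realType) b (alpha : R) n : 0 <= log_sum b alpha n.
Proof. by apply: sumr_ge0 => k _; exact: powR_ge0. Qed.

Lemma walsh_weight_pow_ge0 (R : realType) b (gamma : weights R) (alpha : R) d n
    (k : {ffun 'I_d -> 'I_n}) : 0 <= walsh_weight_pow b gamma alpha k.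
Proof. by rewrite mulr_ge0 ?powR_ge0// prodr_ge0// => j _; exact: powR_ge0. Qed.

(** Vectors inside the box of side b^m are handled by [sum_powR_le]. Any other vector has some entry
    k_j >= b^m, and summing over the possible j in its support costs a factor #|u|. *)
Lemma dual_sum_pow_le (R : realType) b m (gamma : weights R) (alpha : R) (p : {poly 'F_b})
    d (g : 'I_d -> {poly 'F_b}) M :
  prime b -> irreducible_poly p -> size p = m.+1 -> (forall u, 0 < gamma u) ->
  (forall i, g i \in Gstar b m) -> 1 < alpha -> (m <= M)%N ->
  \sum_(k : {ffun 'I_d -> 'I_(b ^ M)} |
      (fsupp k != finset.set0) && dual m p g (fun i => k i))
    walsh_weight_pow b gamma alpha k <=
  dual_sum m gamma p d g `^ alpha +
  (b ^ m)%:R `^ (- alpha) * \sum_(u : {set 'I_d} | u != finset.set0)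
     (wt gamma u `^ alpha * (2 * log_sum b alpha (b ^ M)) ^+ #|u|).
Proof.
move=> pb pirr sp g0 gG a1 mM; have b1 := prime_gt1 pb.
have N0 : (0 < b ^ m)%N by rewrite expn_gt0 prime_gt0.
have N'0 : (0 < b ^ M)%N by rewrite expn_gt0 prime_gt0.
have NN : (b ^ m <= b ^ M)%N by rewrite leq_exp2l.
rewrite (bigID (fun k : {ffun 'I_d -> 'I_(b ^ M)} => [forall j, (k j < b ^ m)%N]))/=.
apply: lerD.
  pose w (k : {ffun 'I_d -> 'I_(b ^ m)}) : {ffun 'I_d -> 'I_(b ^ M)} :=
    [ffun j => widen_ord NN (k j)].
  pose r (k : {ffun 'I_d -> 'I_(b ^ M)}) : {ffun 'I_d -> 'I_(b ^ m)} :=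
    [ffun j => insubd (Ordinal N0) (k j : nat)].
  have wE k j : (w k j : nat) = k j by rewrite ffunE.
  have ws k : fsupp (w k) = fsupp k by apply/setP => j; rewrite !inE wE.
  rewrite (reindex_onto w r); last first.
    move=> k /andP[_ /forallP kN]; apply/ffunP => j; apply: val_inj.
    by rewrite !ffunE /= val_insubd kN.
  apply: le_trans (_ : \sum_(k : {ffun 'I_d -> 'I_(b ^ m)} |
      in_stage d k && dual m p g (fun j => k j)) walsh_weight b gamma k `^ alpha <= _); last first.
    by apply: sum_powR_le => // k; exact: walsh_weight_ge0.
  rewrite le_eqVlt; apply/orP; left; apply/eqP; apply: eq_big => k.
    rewrite ws /in_stage; have -> : fsupp k \subset below d d.
      by apply/fintype.subsetP => j _; rewrite inE.
    have -> : dual m p g (fun i => w k i) = dual m p g (fun i => k i).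
      by apply: eq_forallb => v; congr (_ == _); apply: eq_bigr => j _; rewrite wE.
    have -> : r (w k) == k.
      by apply/eqP/ffunP => j; apply: val_inj; rewrite ffunE val_insubd wE ltn_ord.
    rewrite !andbT; suff -> : [forall j, (w k j < b ^ m)%N] by rewrite andbT.
    by apply/forallP => j; rewrite wE.
  move=> _; rewrite -walsh_weight_powE// /walsh_weight_pow ws; congr (_ * _).
  by apply: eq_bigr => j _; rewrite wE.
pose V (k : {ffun 'I_d -> 'I_(b ^ M)}) := walsh_weight_pow b gamma alpha k.
have V0 k : 0 <= V k by exact: walsh_weight_pow_ge0.
apply: (@le_trans _ _ (\sum_(u : {set 'I_d} | u != finset.set0) \sum_(j in u)
    \sum_(k : {ffun 'I_d -> 'I_(b ^ M)} |
      [&& fsupp k == u, dual m p g (fun i => k i) & (b ^ m <= k j)%N]) V k)).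
  rewrite (partition_big (@fsupp d (b ^ M)) (fun u => u != finset.set0))/=; last first.
    by move=> k /andP[/andP[]].
  apply: ler_sum => u u0; rewrite (exchange_big_dep (fun k : {ffun 'I_d -> 'I_(b ^ M)} =>
      (fsupp k == u) && dual m p g (fun i => k i)))/=; last first.
    by move=> j k ju /and3P[-> ->].
  rewrite [leRHS](bigID (fun k : {ffun 'I_d -> 'I_(b ^ M)} => [forall j, (k j < b ^ m)%N]))/=.
  apply: ler_wpDl.
    by apply: sumr_ge0 => k _; apply: sumr_ge0.
  rewrite [leLHS](eq_bigl (fun k : {ffun 'I_d -> 'I_(b ^ M)} =>
     ((fsupp k == u) && dual m p g (fun i => k i)) && ~~ [forall j, (k j < b ^ m)%N])); last first.
    move=> k; case: (fsupp k =P u) => [->|]; rewrite ?andbF// u0 andbT/=.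
    by [].
  apply: ler_sum => k /andP[/andP[/eqP ku dk]]; rewrite negb_forall => /existsP[j].
  rewrite -leqNgt => kj; rewrite (bigD1 j)/=.
    by rewrite ler_wpDr// sumr_ge0.
  by rewrite ku eqxx dk kj -ku inE -lt0n (leq_trans N0 kj).
rewrite mulr_sumr; apply: ler_sum => u u0.
apply: (@le_trans _ _ (\sum_(j in u) (b ^ m)%:R `^ (- alpha) *
    (wt gamma u `^ alpha * log_sum b alpha (b ^ M) ^+ #|u|))).
  by apply: ler_sum => j ju; exact: dual_high_coord_sum.
rewrite sumr_const -mulrnAr ler_wpM2l ?powR_ge0// -mulrnAr ler_wpM2l ?powR_ge0//.
(* The factor #|u| is absorbed by 2^#|u|, the origin of the 2 in front of mu. *)
rewrite exprMn -mulr_natl ler_wpM2r ?exprn_ge0 ?log_sum_ge0// -natrX ler_nat.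
by rewrite ltnW// ltn_expl.
Qed.

Lemma log_sum_expX (R : realType) b (alpha : R) n : (1 < b)%N ->
  log_sum b alpha (b ^ n) =
  (b%:R - 1) * \sum_(i < n) (b%:R `^ (1 - alpha)) ^+ i.
Proof.
move=> b1; have b0 : 0 < b%:R :> R by rewrite ltr0n ltnW.
elim: n => [|n IH]; first by rewrite /log_sum expn0 big_geq// big_ord0 mulr0.
have le1 : (b ^ n <= b ^ n.+1)%N by rewrite leq_exp2l.
rewrite /log_sum (big_cat_nat (n := b ^ n))//= ?expn_gt0 ?(ltnW b1)//.
rewrite -/(log_sum b alpha (b ^ n)) IH big_ord_recr//= [RHS]mulrDr; congr (_ + _).
rewrite (eq_big_nat _ _ (F2 := fun=> b%:R `^ (- (alpha * n%:R)))); last first.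
  by move=> k /(trunc_log_eq b1) ->.
have E : b%:R ^+ n * b%:R `^ (- (alpha * n%:R)) = (b%:R `^ (1 - alpha)) ^+ n :> R.
  rewrite -powR_mulrn ?(ltW b0)// -powRD; last by apply/implyP => _; rewrite gt_eqF.
  by rewrite -powR_mulrn ?powR_ge0// -powRrM; congr (_ `^ _); ring.
rewrite sumr_const_nat -[LHS]mulr_natl natrB// !natrX exprS -E.
by ring.
Qed.

(** As [walsh_mu] is a [limn], convergence must come first: the partial sums increase and are
    bounded by (b - 1)/(1 - q), a geometric series with ratio q = b^(1 - alpha) < 1. *)
Lemma log_sum_le_mu (R : realType) b (alpha : R) n : (1 < b)%N -> 1 < alpha ->
  log_sum b alpha n <= walsh_mu b alpha.
Proof.
move=> b1 a1; pose q : R := b%:R `^ (1 - alpha).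
have b0 : 0 < b%:R :> R by rewrite ltr0n ltnW.
have q0 : 0 <= q by exact: powR_ge0.
have q1 : q < 1.
  rewrite /q /powR gt_eqF// -[ltRHS]expR0 ltr_expR pmulr_llt0 ?ln_gt0 ?ltr1n//.
  by rewrite subr_lt0.
have mono : {homo log_sum b alpha : k l / (k <= l)%N >-> k <= l}.
  apply/nondecreasing_seqP => k; case: k => [|k]; first by rewrite /log_sum !big_geq.
  by rewrite /log_sum [leRHS]big_nat_recr//= lerDl powR_ge0.
have ub k : log_sum b alpha k <= (b%:R - 1) / (1 - q).
  apply: (le_trans (mono _ _ (ltnW (ltn_expl k b1)))).
  rewrite log_sum_expX// ler_wpM2l ?subr_ge0 ?ler1n ?(ltnW b1)//.
  rewrite -[leRHS]mul1r ler_pdivlMr ?subr_gt0// mulrC -/q.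
  have := subrX1 q k; rewrite -opprB => /(congr1 -%R); rewrite opprK -mulNr opprB => <-.
  by rewrite gerBl exprn_ge0.
apply: (@nondecreasing_cvgn_le R (log_sum b alpha)) => //.
apply: nondecreasing_is_cvgn => //.
by exists ((b%:R - 1) / (1 - q)) => _ [k _ <-].
Qed.

(** * From dual vectors to the worst-case error *)

Local Notation normc := ComplexField.Normc.normc.

Lemma normc_sum (R : realType) (I : Type) (r : seq I) (P : pred I) (F : I -> R[i]) :
  normc (\sum_(i <- r | P i) F i) <= \sum_(i <- r | P i) normc (F i).
Proof.
elim/big_ind2 : _ => [|x x' y y' h h'|//]; first by rewrite ComplexField.Normc.normc0.
by apply: le_trans (lerD h h'); exact: le_normcD.
Qed.

Lemma vmap_itv (R : realType) b m (t : int -> 'F_b) : prime b -> 0 <= vmap R m t < 1.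
Proof.
move=> pb; have b1 := prime_gt1 pb.
have b0 : 0 < b%:R :> R by rewrite ltr0n ltnW.
apply/andP; split.
  by apply: sumr_ge0 => l _; rewrite mulr_ge0// invr_ge0 exprn_ge0// ltW.
have tb l : ((t l%:Z : nat) < b)%N by rewrite -[X in (_ < X)%N](Fp_cast pb) ltn_ord.
have := sum_digits_tail R 0 m b1 tb; rewrite add0n expr0 invr1.
move=> /le_lt_trans; apply.
by rewrite ltrBlDr ltrDl invr_gt0 exprn_gt0.
Qed.

Lemma qmc_rule_wal (R : realType) b m (p : {poly 'F_b}) d (g : d.-tuple {poly 'F_b})
    (k : d.-tuple nat) : prime b ->
  qmc_rule m p g (@wal R b d k) = (dual m p (tnth g) (tnth k))%:R.
Proof.
move=> pb; have N0 : (b ^ m)%:R != 0 :> R[i].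
  by rewrite pnatr_eq0 -lt0n expn_gt0 prime_gt0.
rewrite /qmc_rule (eq_bigr (fun n => \prod_j wal1 b (tnth k j)
    (vmap R m (laurent (nat_poly b n * tnth g j) p)))) => [|n _]; last first.
  by apply: eq_bigr => j _; rewrite tnth_mktuple.
rewrite sum_prod_wal1_dual//; case: ifP => _; last by rewrite mulr0.
by rewrite mulVf.
Qed.

Lemma cube_integral_walsh_coef0 (R : realType) (b d : nat) (f : Defs.point R d -> R[i]) :
  cube_integral f = walsh_coef b f [tuple 0%N | j < d].
Proof.
rewrite /walsh_coef; congr cube_integral; apply/funext => x.
rewrite /wal big1 => [|j _]; last by rewrite tnth_mktuple wal10.
by rewrite rmorph1 mulr1.
Qed.

Lemma rweight_gt0 (R : realType) b (alpha : R) (gamma : weights R) d (k : d.-tuple nat) :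
  (0 < b)%N -> (forall u, 0 < gamma u) -> 0 < rweight b alpha gamma k.
Proof.
move=> b0 g0; rewrite mulr_gt0 ?invr_gt0 ?g0//.
by apply: prodr_gt0 => j _; rewrite powR_gt0// ltr0n.
Qed.

(** Only a finite partial Walsh sum is integrated by the rule: it is uniformly close to f on the
    lattice points, and its error consists of the coefficients at nonzero dual indices, each at most
    1 / [rweight]. Hence bounds on finite sums suffice. *)
Lemma qmc_error_le (R : realType) b m (p : {poly 'F_b}) (alpha : R) (gamma : weights R) (d : nat)
    (g : d.-tuple {poly 'F_b}) (B : R) (f : Defs.point R d -> R[i]) :
  prime b -> (forall u, 0 < gamma u) ->
  (forall A : {fset d.-tuple nat},
    \sum_(k <- A | (supp k != finset.set0) && dual m p (tnth g) (tnth k))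
      (rweight b alpha gamma k)^-1 <= B) ->
  walsh_represented b f -> (walsh_norm b alpha gamma f <= 1)%E ->
  normc (qmc_rule m p g f - cube_integral f) <= B.
Proof.
move=> pb g0 hB frep fnorm; apply/ler_addgt0Pr => e e0.
pose z : d.-tuple nat := [tuple 0%N | j < d].
pose S (A : {fset d.-tuple nat}) x := \sum_(k <- A) walsh_coef b f k * wal b k x.
have coef_le k : normc (walsh_coef b f k) <= (rweight b alpha gamma k)^-1.
  have rw0 := rweight_gt0 alpha k (prime_gt0 pb) g0.
  rewrite -[leRHS]mul1r ler_pdivlMr// -lee_fin; apply: le_trans fnorm.
  by apply: ereal_sup_ubound; exists k.
(* Pointwise convergence at finitely many points yields one index set good for all of them. The zero
   index is added so that the integral of f cancels against its term. *)
have [A [zA hA]] : exists A : {fset d.-tuple nat}, z \in A /\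
    forall n, (n < b ^ m)%N -> normc (S A (lattice_point R m p g n) - f (lattice_point R m p g n)) < e.
  have Ftot : Filter (@totally (d.-tuple nat)).
    exact: (@filter_filter _ _ totally_filter).
  have [n|A0 _ hA0] := @filter_forall {fset d.-tuple nat} 'I_(b ^ m) (fun n A =>
      normc (S A (lattice_point R m p g n) - f (lattice_point R m p g n)) < e) totally Ftot.
    have cubex : cube_co (lattice_point R m p g n).
      by move=> j; rewrite tnth_mktuple; exact: vmap_itv.
    have /cvgrPdist_lt /(_ e e0) := frep _ cubex.
    apply: filterS => A /=; rewrite sub0r normrN; apply: le_lt_trans.
    exact: ler_norm.
  exists (z |` A0)%fset; rewrite fset1U1; split=> // n nN.
  exact: (hA0 _ (fsubsetU1 _ _) (Ordinal nN)).
set N : R[i] := (b ^ m)%:R.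
have N0 : N != 0 by rewrite pnatr_eq0 -lt0n expn_gt0 prime_gt0.
have QS : qmc_rule m p g (S A) = \sum_(k <- A) walsh_coef b f k * (dual m p (tnth g) (tnth k))%:R.
  rewrite /qmc_rule /S exchange_big/= mulr_sumr; apply: eq_bigr => k _.
  by rewrite -(qmc_rule_wal R) // /qmc_rule -mulr_sumr mulrCA.
have -> : qmc_rule m p g f - cube_integral f =
    qmc_rule m p g (fun x => f x - S A x) +
    \sum_(k <- A | (supp k != finset.set0) && dual m p (tnth g) (tnth k)) walsh_coef b f k.
  rewrite (cube_integral_walsh_coef0 b) -/z.
  have -> : qmc_rule m p g (fun x => f x - S A x) = qmc_rule m p g f - qmc_rule m p g (S A).
    by rewrite /qmc_rule sumrB mulrBr.
  rewrite QS (bigD1_seq z)/= ?fset_uniq//.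
  have dz : dual m p (tnth g) (tnth z).
    apply/forallP => v; rewrite big1// => j _.
    by rewrite tnth_mktuple dig0 dotp0l.
  have -> : \sum_(k <- A | (supp k != finset.set0) && dual m p (tnth g) (tnth k))
        walsh_coef b f k =
      \sum_(k <- A | k != z) walsh_coef b f k * (dual m p (tnth g) (tnth k))%:R.
    rewrite big_mkcond [RHS]big_mkcond/=.
    apply: eq_bigr => k _; have -> : (supp k != finset.set0) = (k != z).
      congr (~~ _); apply/eqP/eqP => [/setP k0|->]; last first.
        by apply/setP => j; rewrite !inE tnth_mktuple eqxx.
      apply/eq_from_tnth => j; rewrite tnth_mktuple.
      by have := k0 j; rewrite !inE => /negbFE/eqP.
    by case: eqP; case: dual; rewrite ?mulr1 ?mulr0.
  by rewrite dz mulr1 opprD addrA subrK.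
rewrite addrC; apply: le_trans (le_normcD _ _) _; apply: lerD.
  apply: le_trans (normc_sum _ _ _) _; apply: le_trans (hB A).
  by apply: ler_sum => k _.
rewrite /qmc_rule ComplexField.Normc.normcM ComplexField.Normc.normcV.
have NE : normc N = (b ^ m)%:R.
  by rewrite /N -(rmorph_nat (real_complex R)) /normc /= expr0n addr0 sqrtr_sqr normr_nat.
rewrite NE mulrC ler_pdivrMr ?ltr0n ?expn_gt0 ?prime_gt0//.
apply: le_trans (normc_sum _ _ _) _.
rewrite mulr_natr -[X in _ *+ X]subn0 -sumr_const_nat; apply: ler_sum_nat => n /andP[_ nN].
by rewrite -opprB normcN ltW// hA.
Qed.

Lemma rweight_wpowV (R : realType) b (alpha : R) (gamma : weights R) (d n : nat)
    (k : d.-tuple nat) (h : {ffun 'I_d -> 'I_n}) :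
  (forall j, (h j : nat) = tnth k j) ->
  (rweight b alpha (wpow gamma alpha) k)^-1 = walsh_weight_pow b gamma alpha h.
Proof.
move=> hk; have sk : supp k = fsupp h by apply/setP => j; rewrite !inE hk.
rewrite /rweight invfM invrK /walsh_weight_pow sk; congr (_ * _).
rewrite -prodfV [RHS](bigID (mem (fsupp h)))/= [X in _ * X]big1 ?mulr1.
  by apply: eq_bigr => j _; rewrite hk powRN.
by move=> j; rewrite inE negbK => /eqP ->; rewrite trunc_log0 mulr0 oppr0 powRr0.
Qed.

Lemma sum_rweight_dual_le (R : realType) b m (p : {poly 'F_b}) (alpha : R)
    (gamma : weights R) (d : nat) (g : 'I_d -> {poly 'F_b}) (A : {fset d.-tuple nat}) :
  prime b -> irreducible_poly p -> size p = m.+1 -> (forall u, 0 < gamma u) ->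
  (forall i, g i \in Gstar b m) -> 1 < alpha ->
  \sum_(k <- A | (supp k != finset.set0) && dual m p g (tnth k))
    (rweight b alpha (wpow gamma alpha) k)^-1 <=
  dual_sum m gamma p d g `^ alpha +
  (b ^ m)%:R `^ (- alpha) * \sum_(u : {set 'I_d} | u != finset.set0)
     (wt gamma u `^ alpha * (2 * walsh_mu b alpha) ^+ #|u|).
Proof.
move=> pb pirr sp g0 gG a1; have b1 := prime_gt1 pb.
(* This exponent exceeds m and every entry of every vector in A, so A embeds in the box of side
   b^M. *)
pose M := (m + \sum_(k <- A) \sum_j tnth k j)%N.
have n0 : (0 < b ^ M)%N by rewrite expn_gt0 prime_gt0.
have kM (k : d.-tuple nat) j : k \in A -> (tnth k j < b ^ M)%N.
  move=> kA; apply: leq_ltn_trans (ltn_expl M b1).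
  rewrite /M (bigD1_seq k)/= ?fset_uniq// (bigD1 j)//=.
  by rewrite addnCA -!addnA leq_addr.
pose h (k : d.-tuple nat) : {ffun 'I_d -> 'I_(b ^ M)} :=
  [ffun j => insubd (Ordinal n0) (tnth k j)].
have hE k j : k \in A -> (h k j : nat) = tnth k j.
  by move=> kA; rewrite ffunE val_insubd kM.
have hinj : {in A &, injective h}.
  by move=> k l kA lA hkl; apply/eq_from_tnth => j; rewrite -!hE// hkl.
pose P (k : {ffun 'I_d -> 'I_(b ^ M)}) :=
  (fsupp k != finset.set0) && dual m p g (fun i => k i).
apply: (@le_trans _ _ (\sum_(k | P k) walsh_weight_pow b gamma alpha k)); last first.
  apply: le_trans (dual_sum_pow_le pb pirr sp g0 gG a1 (leq_addr _ _)) _.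
  rewrite lerD2l ler_wpM2l ?powR_ge0//; apply: ler_sum => u _.
  rewrite ler_wpM2l ?powR_ge0// lerXn2r ?nnegrE ?mulr_ge0 ?log_sum_ge0//.
    exact: le_trans (log_sum_ge0 _ _ 0) (log_sum_le_mu _ b1 a1).
  by rewrite ler_wpM2l// log_sum_le_mu.
rewrite big_seq_cond (eq_bigr (fun k => walsh_weight_pow b gamma alpha (h k))); last first.
  by move=> k /andP[kA _]; apply: rweight_wpowV => j; exact: hE.
rewrite (eq_bigl (fun k => (k \in A) && P (h k))); last first.
  move=> k; case: (boolP (k \in A)) => [kA|//]; rewrite !andTb /P.
  have -> : fsupp (h k) = supp k by apply/setP => j; rewrite !inE hE.
  by congr (_ && _); apply: eq_forallb => v; congr (_ == _); apply: eq_bigr => j _; rewrite hE.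
rewrite -big_seq_cond -(big_map h P (fun k => walsh_weight_pow b gamma alpha k)).
rewrite big_mkcond [leRHS]big_mkcond/= big_uniq ?map_inj_in_uniq ?fset_uniq//.
rewrite [leRHS](bigID (mem [seq h i | i <- A]))/= lerDl sumr_ge0// => k _.
by case: ifP => // _; exact: walsh_weight_pow_ge0.
Qed.

(** * The uniform constant and the error bounds *)

(** The admissible constants, gathered in a set so that one is selected from b, the weights and
    delta alone, before m, d, p and alpha are given. *)
Definition stage_bound (R : realType) (b : nat) (gamma : weights R) (delta : R) : set R :=
  [set C | 0 < C /\ forall m d, stage_sum b m gamma d d <= C * (b ^ m)%:R `^ delta].

(* The factor 2 absorbs N / (N - 1). *)
Definition cbc_constant (R : realType) (b : nat) (gamma : weights R) (delta : R) : R :=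
  2 * xget 1 (stage_bound b gamma delta).

Lemma cbc_worst_case_error (R : realType) b (gamma : weights R) (delta : R) : prime b ->
  (forall u, 0 < gamma u) ->
  (\sum_(0 <= j <oo)
     (\big[Num.max/0]_(v : {set 'I_j}) wratio gamma v)%:E < +oo)%E -> 0 < delta ->
  0 < cbc_constant b gamma delta /\
  forall m d, (0 < m)%N -> (0 < d)%N ->
  forall p : {poly 'F_b}, irreducible_poly p -> size p = m.+1 ->
  forall alpha : R, 1 < alpha ->
  let N : R := (b ^ m)%:R in
  (exists g : d.-tuple {poly 'F_b}, cbc_output m gamma p g) /\
  forall g : d.-tuple {poly 'F_b}, cbc_output m gamma p g ->
  (forall j, tnth g j \in Gstar b m) /\
  (worst_case_error m p alpha (wpow gamma alpha) g <=
    (1 / N `^ alpha *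
     (\sum_(u : {set 'I_d} | u != finset.set0)
        wt gamma u `^ alpha * (2 * walsh_mu b alpha) ^+ #|u|
      + cbc_constant b gamma delta `^ alpha * N `^ (alpha * delta)))%:E)%E.
Proof.
move=> pb g0 sumg delta0; have b1 := prime_gt1 pb.
have [C0 hC] : stage_bound b gamma delta (xget 1 (stage_bound b gamma delta)).
  apply: xgetPex; have [C C0 hC] := stage_sum_le b1 g0 sumg delta0.
  by exists C; split.
rewrite /cbc_constant; set C := xget _ _ in C0 hC *.
split=> [|m d m0 d0 p pirr sp alpha a1]; first by rewrite mulr_gt0.
set N : R := (b ^ m)%:R.
split=> [|g cbc]; first exact: cbc_output_exists.
have gG := cbc_output_Gstar m0 cbc; split=> //.
have N2 : 2 <= N.
  by rewrite ler_nat (leq_trans b1)// -{1}[b]expn1 leq_exp2l.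
have N0 : 0 < N by rewrite (lt_le_trans _ N2).
set T := dual_sum m gamma p d (tnth g).
have T0 : 0 <= T by apply: sumr_ge0 => k _; exact: walsh_weight_ge0.
(* From (N - 1) T <= C N^delta and N <= 2 (N - 1). *)
have TC : T <= 2 * C * N `^ delta / N.
  rewrite ler_pdivlMr//.
  have := le_trans (dual_sum_cbc pb pirr sp g0 cbc) (hC m d); rewrite -/N -/T.
  move=> h; nra.
apply/ereal_supP => _ [f [[_ _ frep] fnorm] <-]; rewrite lee_fin.
have wp0 u : 0 < wpow gamma alpha u by rewrite powR_gt0.
apply: (qmc_error_le pb wp0 _ frep fnorm) => A.
apply: le_trans (sum_rweight_dual_le A pb pirr sp g0 gG a1) _.
rewrite -/N -/T powRN div1r mulrDr addrC lerD2l.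
apply: (@le_trans _ _ ((2 * C * N `^ delta / N) `^ alpha)).
  have a0 : 0 <= alpha by rewrite ltW// (lt_trans _ a1).
  by apply: (ge0_ler_powR a0); rewrite // nnegrE // (le_trans T0).
rewrite !powRM ?powR_ge0 ?mulr_ge0 ?invr_ge0 ?(ltW N0) ?(ltW C0)//.
rewrite -powRrM [delta * _]mulrC -powR_inv1 ?(ltW N0)// -powRrM mulN1r powRN.
  by rewrite [leLHS]mulrC.
exact: powR_ge0.
Qed.

Theorem corollary1 (R : realType) (b : nat) (b_prime : prime b) :
  (exists C1 : weights R -> R -> R,
    forall gamma : weights R,
    (forall u, 0 < gamma u) ->
    (\sum_(0 <= j <oo)
       (\big[Num.max/0]_(v : {set 'I_j}) wratio gamma v)%:E < +oo)%E ->
    forall delta : R, 0 < delta ->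
    0 < C1 gamma delta /\
    forall (m d : nat), (4 <= m)%N -> (1 <= d)%N ->
    forall p : {poly 'F_b}, irreducible_poly p -> size p = m.+1 ->
    forall alpha : R, 1 < alpha ->
    let N : R := (b ^ m)%:R in
    (exists g : d.-tuple {poly 'F_b}, cbc_output m gamma p g) /\
    forall g : d.-tuple {poly 'F_b}, cbc_output m gamma p g ->
    (forall j, tnth g j \in Gstar b m) /\
    (worst_case_error m p alpha (wpow gamma alpha) g <=
      (1 / N `^ alpha *
       (\sum_(u : {set 'I_d} | u != finset.set0)
          wt gamma u `^ alpha * (2 * walsh_mu b alpha) ^+ #|u|
        + C1 gamma delta `^ alpha * N `^ (alpha * delta)))%:E)%E)
  /\
  (exists C2 : weights R -> R -> R,
    forall gamma : weights R,
    (forall u, 0 < gamma u) ->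
    forall alpha : R, 1 < alpha ->
    (\sum_(0 <= j <oo)
       (\big[Num.max/0]_(v : {set 'I_j}) (wratio gamma v `^ alpha^-1))%:E
       < +oo)%E ->
    forall delta : R, 0 < delta ->
    0 < C2 (wpow gamma alpha^-1) delta /\
    forall (m d : nat), (4 <= m)%N -> (1 <= d)%N ->
    forall p : {poly 'F_b}, irreducible_poly p -> size p = m.+1 ->
    let N : R := (b ^ m)%:R in
    (exists g : d.-tuple {poly 'F_b},
       cbc_output m (wpow gamma alpha^-1) p g) /\
    forall g : d.-tuple {poly 'F_b},
    cbc_output m (wpow gamma alpha^-1) p g ->
    (forall j, tnth g j \in Gstar b m) /\
    (worst_case_error m p alpha gamma g <=
      (1 / N `^ alpha *
       (\sum_(u : {set 'I_d} | u != finset.set0)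
          wt gamma u * (2 * walsh_mu b alpha) ^+ #|u|
        + C2 (wpow gamma alpha^-1) delta `^ alpha * N `^ (alpha * delta)))%:E)%E).
Proof.
have b1 := prime_gt1 b_prime.
split; exists (@cbc_constant R b) => gamma g0.
  move=> sumg delta delta0; have [C0 H] := cbc_worst_case_error b_prime g0 sumg delta0.
  split=> // m d m4 d1 p pirr sp alpha a1.
  by apply: H => //; apply: leq_trans m4.
(* The ratios of gamma^(1/alpha) are the 1/alpha-th powers of those of gamma, so the assumed
   summability is the one required for [eta]; raising [eta] to the power alpha restores gamma. *)
move=> alpha a1 sumg delta delta0; set eta := wpow gamma alpha^-1.
have a0 : 0 < alpha by rewrite (lt_trans _ a1).
have eta0 u : 0 < eta u by rewrite powR_gt0.
have etaK : wpow eta alpha = gamma.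
  apply/funext => u; rewrite /wpow /eta /wpow -powRrM mulVf ?gt_eqF// powRr1//.
  exact: ltW.
have ratioE j (v : {set 'I_j}) : wratio eta v = wratio gamma v `^ alpha^-1.
  rewrite /wratio /wt /eta /wpow powRM ?invr_ge0 ?(ltW (g0 _))//; congr (_ * _).
  by rewrite -[in RHS]powR_inv1 ?(ltW (g0 _))// -powRrM mulN1r powRN.
have sumeta : (\sum_(0 <= j <oo)
    (\big[Num.max/0]_(v : {set 'I_j}) wratio eta v)%:E < +oo)%E.
  by under eq_eseriesr do under eq_bigr do rewrite ratioE.
have [C0 H] := cbc_worst_case_error b_prime eta0 sumeta delta0.
split=> // m d m4 d1 p pirr sp.
have m0 : (0 < m)%N by apply: leq_trans m4.
have [exg Hg] := H m d m0 d1 p pirr sp alpha a1.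
split=> [|g /Hg[gG]]; first exact: exg.
rewrite etaK => err; split=> //.
have wtE u : wt eta u `^ alpha = wt gamma u :> R by exact: (congr1 (fun w => wt w u) etaK).
by under eq_bigr do rewrite -wtE.
Qed.
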